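(* Let $E_1=\mathbb{C}/\Gamma_1$ and $E_2=\mathbb{C}/\Gamma_2$ be elliptic curves and $X=E_1\times E_2$, equipped with the Hermitian form $\omega$ induced by the Euclidean form $\frac{\sqrt{-1}}{2}(dz_1\wedge d\bar z_1+dz_2\wedge d\bar z_2)$ on $\mathbb{C}^2$. There exists an entire curve $g:\mathbb{C}\to X$ such that for every $e_1\in E_1$ there is an increasing sequence of radii $r_\ell\nearrow\infty$ for which the concentric discs $g\restriction_{\mathbb{D}_{r_\ell}}$ produce Nevanlinna currents and Ahlfors currents (along subsequences), and every such current is a positive multiple of the current of integration $[\{e_1\}\times E_2]$; and likewise for every $e_2\in E_2$ there is an increasing sequence of radii $r'_\ell\nearrow\infty$ for which the discs $g\restriction_{\mathbb{D}_{r'_\ell}}$ produce Nevanlinna and Ahlfors currents, each a positive multiple of $[E_1\times\{e_2\}]$.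
   Context: $\mathbb{D}_r$ denotes the open disc of radius $r$ centered at $0$ in $\mathbb{C}$. For a nonconstant holomorphic disc $f:\mathbb{D}_R\to X$ that is the restriction of a holomorphic map on a neighborhood of $\overline{\mathbb{D}}_R$, set $T_f(\eta)=\int_0^R\frac{dt}{t}\int_{\mathbb{D}_t}f^*\eta$ for smooth $(1,1)$-forms $\eta$ and $L_f(\omega)=\int_0^R\mathrm{Length}_\omega(f(\partial\mathbb{D}_t))\frac{dt}{t}$. A sequence of such discs $f_i:\mathbb{D}_{r_i}\to X$ produces Nevanlinna currents if $L_{f_i}(\omega)/T_{f_i}(\omega)\to0$; the Nevanlinna currents are the weak limits of subsequences of $T_{f_i}/T_{f_i}(\omega)$. It produces Ahlfors currents if $\mathrm{Length}_\omega(f_i(\partial\mathbb{D}_{r_i}))/\mathrm{Area}_\omega(f_i(\mathbb{D}_{r_i}))\to0$; the Ahlfors currents are the weak limits of subsequences of $[f_i(\mathbb{D}_{r_i})]/\mathrm{Area}_\omega(f_i(\mathbb{D}_{r_i}))$, where $[f_i(\mathbb{D}_{r_i})](\eta)=\int_{\mathbb{D}_{r_i}}f_i^*\eta$. *)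

(* Defs.v *)
From Stdlib Require Import Reals.
From Coquelicot Require Import Coquelicot.
Open Scope R_scope.

Definition lattice (a b : C) (g : C) : Prop :=
  exists m n : Z, g = (RtoC (IZR m) * a + RtoC (IZR n) * b)%C.
(* a, b are R-linearly independent *)
Definition nondeg (a b : C) : Prop := Im (Cconj a * b) <> 0.

Definition shiftR (p v : C * C) (t : R) : C * C :=
  ((fst p + RtoC t * fst v)%C, (snd p + RtoC t * snd v)%C).
Definition coord_dir (v : C * C) : Prop :=
  v = (RtoC 1, RtoC 0) \/ v = ((0, 1) : C, RtoC 0) \/
  v = (RtoC 0, RtoC 1) \/ v = (RtoC 0, (0, 1) : C).
Definition pderiv (v : C * C) (f : C * C -> R) (p : C * C) : R :=
  Derive (fun t => f (shiftR p v t)) 0.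
Fixpoint Ck (k : nat) (f : C * C -> R) : Prop :=
  (forall p : C * C, continuous f p) /\
  match k with
  | O => True
  | S k' => forall v, coord_dir v ->
      (forall p, ex_derive (fun t => f (shiftR p v t)) 0) /\ Ck k' (pderiv v f)
  end.
Definition smoothC (f : C * C -> C) : Prop :=
  forall k, Ck k (fun p => Re (f p)) /\ Ck k (fun p => Im (f p)).

(** * (1,1)-forms on X = E1 x E2
   eta = (i/2) sum_{j,k} c_jk dz_j /\ dz_k-bar, with coefficients on C^2;
   forms on X = Gamma1 x Gamma2 - periodic forms on C^2. *)
Record form11 := Form11 {
  c11 : C * C -> C; c12 : C * C -> C; c21 : C * C -> C; c22 : C * C -> C }.

Definition periodic (a1 b1 a2 b2 : C) (f : C * C -> C) : Prop :=
  forall (p : C * C) (g1 g2 : C), lattice a1 b1 g1 -> lattice a2 b2 g2 ->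
    f ((fst p + g1)%C, (snd p + g2)%C) = f p.

Definition test_form (a1 b1 a2 b2 : C) (eta : form11) : Prop :=
  smoothC (c11 eta) /\ smoothC (c12 eta) /\ smoothC (c21 eta) /\ smoothC (c22 eta) /\
  periodic a1 b1 a2 b2 (c11 eta) /\ periodic a1 b1 a2 b2 (c12 eta) /\
  periodic a1 b1 a2 b2 (c21 eta) /\ periodic a1 b1 a2 b2 (c22 eta).

Definition omega : form11 :=
  Form11 (fun _ => RtoC 1) (fun _ => RtoC 0) (fun _ => RtoC 0) (fun _ => RtoC 1).

(** * Entire curves C -> X, given by a holomorphic lift (g1, g2) : C -> C^2
   together with its complex derivative (dg1, dg2). *)
Record curve := Curve { g1 : C -> C; g2 : C -> C; dg1 : C -> C; dg2 : C -> C }.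

Definition entire (g : curve) : Prop :=
  (forall z : C, is_derive (K := C_AbsRing) (V := C_NormedModule) (g1 g) z (dg1 g z)) /\
  (forall z : C, is_derive (K := C_AbsRing) (V := C_NormedModule) (g2 g) z (dg2 g z)).

Definition nonconst_on (g : curve) (r : R) : Prop :=
  exists z : C, Cmod z < r /\ (g1 g z <> g1 g (RtoC 0) \/ g2 g z <> g2 g (RtoC 0)).

(* density of g^* eta with respect to Lebesgue measure dx dy on C *)
Definition pull (eta : form11) (g : curve) (z : C) : C :=
  let p := (g1 g z, g2 g z) in
  (c11 eta p * dg1 g z * Cconj (dg1 g z) + c12 eta p * dg1 g z * Cconj (dg2 g z) +
   c21 eta p * dg2 g z * Cconj (dg1 g z) + c22 eta p * dg2 g z * Cconj (dg2 g z))%C.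

Definition CInt (f : R -> C) (a b : R) : C :=
  (RInt (fun x => Re (f x)) a b, RInt (fun x => Im (f x)) a b).
Definition pol (s th : R) : C := (s * cos th, s * sin th).
(* integral over the disc D_t, in polar coordinates (dA = s ds dtheta) *)
Definition disc_int (h : C -> C) (t : R) : C :=
  CInt (fun s => CInt (fun th => (h (pol s th) * RtoC s)%C) 0 (2 * PI)) 0 t.

Definition image_current (g : curve) (r : R) (eta : form11) : C :=
  disc_int (pull eta g) r.
Definition Tnev (g : curve) (R0 : R) (eta : form11) : C :=
  CInt (fun t => (disc_int (pull eta g) t / RtoC t)%C) 0 R0.
Definition bdry_length (g : curve) (t : R) : R :=
  RInt (fun th => sqrt (Cmod (dg1 g (pol t th)) ^ 2 + Cmod (dg2 g (pol t th)) ^ 2) * t)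
       0 (2 * PI).
Definition Lnev (g : curve) (R0 : R) : R :=
  RInt (fun t => bdry_length g t / t) 0 R0.
Definition Area (g : curve) (r : R) : R := Re (image_current g r omega).

Definition radii (r : nat -> R) : Prop :=
  (forall l, 0 < r l /\ r l < r (S l)) /\ is_lim_seq r p_infty.

Definition produces_nevanlinna (g : curve) (r : nat -> R) : Prop :=
  (forall l, nonconst_on g (r l)) /\
  is_lim_seq (fun l => Lnev g (r l) / Re (Tnev g (r l) omega)) 0.

Definition produces_ahlfors (g : curve) (r : nat -> R) : Prop :=
  (forall l, nonconst_on g (r l)) /\
  is_lim_seq (fun l => bdry_length g (r l) / Area g (r l)) 0.

Definition subseq (phi : nat -> nat) : Prop := forall n, (phi n < phi (S n))%nat.

Definition nevanlinna_current (a1 b1 a2 b2 : C) (g : curve) (r : nat -> R)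
    (T : form11 -> C) : Prop :=
  exists phi, subseq phi /\
  forall eta, test_form a1 b1 a2 b2 eta ->
    filterlim (fun l => (Tnev g (r (phi l)) eta / RtoC (Re (Tnev g (r (phi l)) omega)))%C)
      eventually (locally (T eta)).

Definition ahlfors_current (a1 b1 a2 b2 : C) (g : curve) (r : nat -> R)
    (T : form11 -> C) : Prop :=
  exists phi, subseq phi /\
  forall eta, test_form a1 b1 a2 b2 eta ->
    filterlim (fun l => (image_current g (r (phi l)) eta / RtoC (Area g (r (phi l))))%C)
      eventually (locally (T eta)).

(* [{e1} x E2](eta) = int_{E2} eta_{22}(e1, .) dA, E2 parametrized by the
   fundamental parallelogram {s a2 + t b2 : s,t in [0,1]}. *)
Definition fiber1_current (a2 b2 e1 : C) (eta : form11) : C :=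
  (RtoC (Rabs (Im (Cconj a2 * b2))) *
   CInt (fun s => CInt (fun t =>
     c22 eta (e1, (RtoC s * a2 + RtoC t * b2)%C)) 0 1) 0 1)%C.
Definition fiber2_current (a1 b1 e2 : C) (eta : form11) : C :=
  (RtoC (Rabs (Im (Cconj a1 * b1))) *
   CInt (fun s => CInt (fun t =>
     c11 eta ((RtoC s * a1 + RtoC t * b1)%C, e2)) 0 1) 0 1)%C.

Definition positive_multiple (a1 b1 a2 b2 : C) (T S : form11 -> C) : Prop :=
  exists c : R, 0 < c /\
  forall eta, test_form a1 b1 a2 b2 eta -> T eta = (RtoC c * S eta)%C.

(* Main.v *)
(** The curve is the limit of pairs of entire functions, corrected by exponentials on larger and
    larger discs.  At a step of radius [r] with target [e] in the first factor, one first adds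
    [c exp (N' (z - r))] to the first function so that it takes the value [e] at [r], and then
    [exp (N (z - r + 1/2))] to the second one, with [N] enormous.  Both terms are negligible on the
    disc of radius [r - 1], so the sums converge; on the disc of radius [r] the second one carries
    almost all the area, all of it near [z = r], where the first function is close to [e].  The
    targets run infinitely often through a dense sequence, alternately in both factors.
    For a test form, the coefficients other than [c22] then contribute little by Cauchy-Schwarz, and
    [c22 (g1, g2)] may be replaced by [c22 (e, g2)].  On the torus, [c22 (e, .)] minus its mean is
    the differential of a bounded 1-form, so by Green's formula its integral over the image of the
    disc is bounded by the length of the boundary, which is negligible with respect to the area.
    The same estimates hold for the logarithmic averages that define Nevanlinna currents. *)

Require Import Defs.
From Stdlib Require Import ZArith Reals Lra Lia Classical ClassicalEpsilon FunctionalExtensionality Cantor.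
From Coquelicot Require Import Coquelicot.
Open Scope R_scope.

(** * Continuous functions *)

Definition continuous_fun {U V : UniformSpace} (f : U -> V) : Prop := forall x : U, continuous f x.

Definition jointly_continuous {U V W : UniformSpace} (f : U -> V -> W) : Prop :=
  continuous_fun (fun q : U * V => f (fst q) (snd q)).

Section ContinuityRules.
Context {U : UniformSpace}.

Lemma continuous_pair {V W : UniformSpace} (f : U -> V) (g : U -> W) x :
  continuous f x -> continuous g x ->
  continuous (U := prod_UniformSpace V W) (fun y => (f y, g y)) x.
Proof.
  intros Hf Hg; apply (continuous_comp_2 f g pair); auto.
  apply continuous_ext with (f := fun p : V * W => p).
  - now intros [].
  - apply continuous_id.
Qed.

Lemma continuous_fst_comp {V W : UniformSpace} (f : U -> V * W) x :
  continuous f x -> continuous (fun y => fst (f y)) x.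
Proof.
  intros H; apply (continuous_comp f fst); auto. destruct (f x); apply continuous_fst.
Qed.

Lemma continuous_snd_comp {V W : UniformSpace} (f : U -> V * W) x :
  continuous f x -> continuous (fun y => snd (f y)) x.
Proof.
  intros H; apply (continuous_comp f snd); auto. destruct (f x); apply continuous_snd.
Qed.

Lemma continuous_pow (f : U -> R) n x : continuous f x -> continuous (fun y => f y ^ n) x.
Proof.
  intros H; induction n as [|n IH]; simpl; [apply continuous_const|].
  now apply (continuous_mult (K := R_AbsRing) f).
Qed.

Lemma continuous_Re (f : U -> C) x : continuous f x -> continuous (fun y => Re (f y)) x.
Proof. apply continuous_fst_comp. Qed.

Lemma continuous_Im (f : U -> C) x : continuous f x -> continuous (fun y => Im (f y)) x.
Proof. apply continuous_snd_comp. Qed.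

Lemma continuous_Re_Im (f : U -> C) x :
  continuous (fun y => Re (f y)) x -> continuous (fun y => Im (f y)) x -> continuous f x.
Proof.
  intros HRe HIm. apply continuous_ext with (fun y => (Re (f y), Im (f y))).
  - intros y; now destruct (f y).
  - now apply continuous_pair.
Qed.

Lemma continuous_RtoC (f : U -> R) x : continuous f x -> continuous (fun y => RtoC (f y)) x.
Proof. intros H; apply continuous_pair; [exact H|apply continuous_const]. Qed.

Lemma continuous_Cmult (f g : U -> C) x :
  continuous f x -> continuous g x -> continuous (fun y => (f y * g y)%C) x.
Proof.
  intros Hf Hg.
  assert (Ref := continuous_Re f x Hf). assert (Imf := continuous_Im f x Hf).
  assert (Reg := continuous_Re g x Hg). assert (Img := continuous_Im g x Hg).
  apply continuous_Re_Im.
  - exact (continuous_minus (V := R_NormedModule) _ _ _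
      (continuous_mult (K := R_AbsRing) _ _ _ Ref Reg) (continuous_mult (K := R_AbsRing) _ _ _ Imf Img)).
  - exact (continuous_plus (V := R_NormedModule) _ _ _
      (continuous_mult (K := R_AbsRing) _ _ _ Ref Img) (continuous_mult (K := R_AbsRing) _ _ _ Imf Reg)).
Qed.

Lemma continuous_Cconj (f : U -> C) x : continuous f x -> continuous (fun y => Cconj (f y)) x.
Proof.
  intros Hf; apply continuous_pair; [now apply continuous_Re|].
  now apply (continuous_opp (V := R_NormedModule)), continuous_Im.
Qed.

Lemma continuous_Cmod (f : U -> C) x : continuous f x -> continuous (fun y => Cmod (f y)) x.
Proof.
  intros H; apply (continuous_comp _ sqrt); [|apply continuous_sqrt].
  apply (continuous_plus (V := R_NormedModule)); apply continuous_pow;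
    [now apply continuous_fst_comp|now apply continuous_snd_comp].
Qed.

Lemma continuous_pol (f g : U -> R) x :
  continuous f x -> continuous g x -> continuous (fun y => pol (f y) (g y)) x.
Proof.
  intros Hf Hg; apply continuous_pair; apply (continuous_mult (K := R_AbsRing)); try exact Hf.
  - apply (continuous_comp g cos); [exact Hg|apply continuous_cos].
  - apply (continuous_comp g sin); [exact Hg|].
    apply (ex_derive_continuous sin). eexists; apply is_derive_sin.
Qed.

Lemma jointly_continuous_comp {V W X : UniformSpace} (f : V -> W -> X) (g : U -> V) (h : U -> W) x :
  jointly_continuous f -> continuous g x -> continuous h x -> continuous (fun y => f (g y) (h y)) x.
Proof. intros Hf Hg Hh; now apply (continuous_comp_2 g h f). Qed.
End ContinuityRules.

Ltac continuous_step :=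
  match goal with
  | |- continuous (fun x => ?c) _ => apply continuous_const
  | |- continuous (fun x => x) _ => apply continuous_id
  | |- continuous (fun x => (@?f x + @?g x)%R) _ => apply (continuous_plus (V := R_NormedModule) f g)
  | |- continuous (fun x => (@?f x - @?g x)%R) _ => apply (continuous_minus (V := R_NormedModule) f g)
  | |- continuous (fun x => (@?f x * @?g x)%R) _ => apply (continuous_mult (K := R_AbsRing) f g)
  | |- continuous (fun x => (- @?f x)%R) _ => apply (continuous_opp (V := R_NormedModule) f)
  | |- continuous (fun x => (@?f x ^ ?n)%R) _ => apply (continuous_pow f n)
  | |- continuous (fun x => sqrt (@?f x)) _ => apply (continuous_comp f sqrt); [|apply continuous_sqrt]
  | |- continuous (fun x => Rabs (@?f x)) _ => apply (continuous_comp f Rabs); [|apply continuous_Rabs]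
  | |- continuous (fun x => exp (@?f x)) _ => apply (continuous_comp f exp); [|apply continuous_exp]
  | |- continuous (fun x => cos (@?f x)) _ => apply (continuous_comp f cos); [|apply continuous_cos]
  | |- continuous (fun x => sin (@?f x)) _ =>
      apply (continuous_comp f sin); [|apply (ex_derive_continuous sin); eexists; apply is_derive_sin]
  | |- continuous (fun x => Cplus (@?f x) (@?g x)) _ => apply (continuous_plus (V := C_NormedModule) f g)
  | |- continuous (fun x => Cminus (@?f x) (@?g x)) _ => apply (continuous_minus (V := C_NormedModule) f g)
  | |- continuous (fun x => Cmult (@?f x) (@?g x)) _ => apply (continuous_Cmult f g)
  | |- continuous (fun x => Cconj (@?f x)) _ => apply (continuous_Cconj f)
  | |- continuous (fun x => RtoC (@?f x)) _ => apply (continuous_RtoC f)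
  | |- continuous (fun x => Cmod (@?f x)) _ => apply (continuous_Cmod f)
  | |- continuous (fun x => pol (@?f x) (@?g x)) _ => apply (continuous_pol f g)
  | |- continuous (fun x => Re (@?f x)) _ => apply (continuous_Re f)
  | |- continuous (fun x => Im (@?f x)) _ => apply (continuous_Im f)
  | |- continuous (fun x => (@?f x, @?g x)) _ => apply (continuous_pair f g)
  | |- continuous (fun x => fst (@?f x)) _ => apply (continuous_fst_comp f)
  | |- continuous (fun x => snd (@?f x)) _ => apply (continuous_snd_comp f)
  | H : continuous_fun ?h |- continuous ?h _ => apply H
  | H : continuous_fun ?h |- continuous (fun x => ?h (@?f x)) _ => apply (continuous_comp f h); [|apply H]
  | H : forall z, continuous ?h z |- continuous ?h _ => apply H
  | H : forall z, continuous ?h z |- continuous (fun x => ?h (@?f x)) _ =>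
      apply (continuous_comp f h); [|apply H]
  | H : jointly_continuous ?h |- continuous (fun x => ?h (@?f x) (@?g x)) _ =>
      apply (jointly_continuous_comp h f g); [exact H| |]
  end.

Ltac auto_continuous :=
  match goal with
  | |- continuous_fun _ => let x := fresh "x" in intros x
  | |- jointly_continuous _ => let x := fresh "x" in intros x
  | |- forall _, continuous _ _ => let x := fresh "x" in intros x
  | |- _ => idtac
  end; repeat (cbv beta; continuous_step).

Lemma jointly_continuous_slice {V W X : UniformSpace} (f : V -> W -> X) (v : V) :
  jointly_continuous f -> continuous_fun (f v).
Proof. intros Hf w. apply (jointly_continuous_comp f (fun _ => v) (fun w => w)); auto_continuous; auto. Qed.

Lemma tube_lemma {U : UniformSpace} (P : U -> R -> Prop) (a b : R) (p : U) :
  (forall t, a <= t <= b -> locally (p, t) (fun q => P (fst q) (snd q))) ->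
  locally p (fun q => forall t, a <= t <= b -> P q t).
Proof.
  intros H.
  assert (box : forall t, exists d : posreal, a <= t <= b ->
    forall q s, ball p d q -> Rabs (s - t) < d -> P q s).
  { intros t. destruct (classic (a <= t <= b)) as [Ht|Ht]; [|now exists (mkposreal 1 Rlt_0_1)].
    destruct (H t Ht) as [d Hd]. exists d. intros _ q s Hq Hs. now apply (Hd (q, s)). }
  destruct (compactness_value_1d a b (fun t => proj1_sig (constructive_indefinite_description _ (box t))))
    as [d Hd].
  exists d. intros q Hq s Hs. apply NNPP; intros HP. apply (Hd s Hs). intros [t [Ht [Hst Hdt]]]. apply HP.
  destruct (constructive_indefinite_description _ (box t)) as [dt Hbox]; simpl in *.
  apply (Hbox Ht); auto. now apply ball_le with d.
Qed.

Lemma ex_RInt_continuous_fun (f : R -> R) a b : continuous_fun f -> ex_RInt f a b.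
Proof. intros H; apply (ex_RInt_continuous (V := R_CompleteNormedModule)); auto. Qed.

Lemma continuous_RInt_param {U : UniformSpace} (f : U -> R -> R) (a b : R) :
  jointly_continuous f -> a <= b -> continuous_fun (fun p => RInt (f p) a b).
Proof.
  intros Hf Hab p. apply filterlim_locally; intros eps.
  assert (Hslice : forall q, ex_RInt (f q) a b).
  { intros q; now apply ex_RInt_continuous_fun, jointly_continuous_slice. }
  assert (He : 0 < eps / (b - a + 1)) by (apply Rdiv_lt_0_compat; [apply cond_pos|lra]).
  eapply filter_imp; [|apply (tube_lemma (fun q t => Rabs (f q t - f p t) < eps / (b - a + 1)) a b)].
  - intros q Hq. change (Rabs (RInt (f q) a b - RInt (f p) a b) < eps).
    replace (RInt (f q) a b - RInt (f p) a b) with (RInt (fun t => minus (f q t) (f p t)) a b)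
      by (now rewrite (RInt_minus (V := R_CompleteNormedModule))).
    eapply Rle_lt_trans.
    + apply (abs_RInt_le_const _ _ _ (eps / (b - a + 1))); auto.
      * now apply (ex_RInt_minus (V := R_NormedModule)).
      * intros t Ht. now apply Rlt_le, Hq.
    + apply Rlt_le_trans with ((b - a + 1) * (eps / (b - a + 1))); [nra|right; field; lra].
  - intros t _.
    assert (Hc : continuous (fun q : U * R => f (fst q) (snd q) - f p (snd q)) (p, t)) by auto_continuous.
    apply filterlim_locally with (eps := mkposreal _ He) in Hc.
    eapply filter_imp; [|exact Hc]. intros q Hq.
    change (Rabs (f (fst q) (snd q) - f p (snd q) - (f p t - f p t)) < eps / (b - a + 1)) in Hq.
    now rewrite Rminus_diag, Rminus_0_r in Hq.
Qed.

Lemma locally_bounded_box n (f : Compactness.Tn n R -> R) (a b : Compactness.Tn n R) :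
  (forall p, exists (d : posreal) M, forall q, Compactness.close_n n d q p -> f q <= M) ->
  exists M, forall q, Compactness.bounded_n n a b q -> f q <= M.
Proof.
  intros H.
  assert (inv_bound : forall p, exists d : posreal, forall q, Compactness.close_n n d q p -> f q <= / d).
  { intros p. destruct (H p) as [d [M HM]].
    assert (HM0 : 0 < Rabs M + 1) by (generalize (Rabs_pos M); lra).
    assert (Hd : 0 < Rmin d (/ (Rabs M + 1)))
      by (apply Rmin_pos; [apply cond_pos|now apply Rinv_0_lt_compat]).
    exists (mkposreal _ Hd). intros q Hq. simpl in *.
    apply Rle_trans with (/ / (Rabs M + 1)).
    - rewrite Rinv_inv. generalize (Rle_abs M).
      assert (f q <= M); [apply HM|lra].
      clear - Hq. revert q p Hq. induction n as [|n IH]; [easy|].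
      intros [q q'] [p p'] [Hq Hq']. split; [|now apply IH].
      eapply Rlt_le_trans; [exact Hq|apply Rmin_l].
    - apply Rinv_le_contravar; [exact Hd|apply Rmin_r]. }
  pose (delta := fun p => proj1_sig (constructive_indefinite_description _ (inv_bound p))).
  destruct (compactness_value n a b delta) as [d Hd].
  exists (/ d). intros q Hq. apply NNPP; intros HN. apply (Hd q Hq). intros [p [_ [Hqp Hdp]]]. apply HN.
  unfold delta in *.
  destruct (constructive_indefinite_description _ (inv_bound p)) as [dp Hdp']; simpl in *.
  eapply Rle_trans; [now apply Hdp'|]. apply Rinv_le_contravar; [apply cond_pos|exact Hdp].
Qed.

Lemma continuous_bounded_polydisc (f : C * C -> R) r : continuous_fun f ->
  exists M, forall z w, Cmod z <= r -> Cmod w <= r -> f (z, w) <= M.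
Proof.
  intros Hf.
  destruct (locally_bounded_box 4 (fun q => match q with (x, (y, (u, (v, _)))) => f ((x, y), (u, v)) end)
    (- r, (- r, (- r, (- r, tt)))) (r, (r, (r, (r, tt))))) as [M HM].
  - intros [x [y [u [v []]]]].
    destruct (proj1 (filterlim_locally _ _) (Hf ((x, y), (u, v))) (mkposreal 1 Rlt_0_1)) as [d Hd].
    exists d, (f ((x, y), (u, v)) + 1). intros [x' [y' [u' [v' []]]]] [Hx [Hy [Hu [Hv _]]]].
    specialize (Hd ((x', y'), (u', v')) (conj (conj Hx Hy) (conj Hu Hv))).
    apply Rabs_def2 in Hd. simpl in Hd. unfold minus, plus, opp in Hd; simpl in Hd. lra.
  - exists M. intros [x y] [u v] Hz Hw. apply (HM (x, (y, (u, (v, tt))))).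
    assert (coordinates : forall c : C, Cmod c <= r -> - r <= Re c <= r /\ - r <= Im c <= r).
    { intros c Hc. assert (Hm := Rmax_Cmod c).
      split; apply Rabs_le_between; eauto using Rle_trans, Rmax_l, Rmax_r. }
    destruct (coordinates _ Hz), (coordinates _ Hw). now repeat split.
Qed.

(** * Complex derivatives *)

Local Notation is_Cderive := (is_derive (K := C_AbsRing) (V := C_NormedModule)).
Local Notation R2_NormedModule := (prod_NormedModule R_AbsRing R_NormedModule R_NormedModule).

Lemma norm_prod_Cmod (c : C) : norm (V := R2_NormedModule) c = Cmod c.
Proof.
  change (sqrt (Rabs (fst c) ^ 2 + Rabs (snd c) ^ 2) = Cmod c). now rewrite !pow2_abs.
Qed.

Lemma Rabs_Im_le_Cmod (c : C) : Rabs (Im c) <= Cmod c.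
Proof. eapply Rle_trans; [apply Rmax_r|apply Rmax_Cmod]. Qed.

Lemma Cmod_le_Rabs_Re_Im (c : C) : Cmod c <= Rabs (Re c) + Rabs (Im c).
Proof.
  assert (pos_Re := Rabs_pos (Re c)). assert (pos_Im := Rabs_pos (Im c)).
  apply Rsqr_incr_0_var; [|lra].
  rewrite !Rsqr_pow2, Cmod2_alt, <- (pow2_abs (Re c)), <- (pow2_abs (Im c)). nra.
Qed.

Lemma is_Cderive_iff (f : C -> C) (z l : C) :
  is_Cderive f z l <-> forall eps : posreal,
    locally z (fun w => Cmod (f w - f z - l * (w - z))%C <= eps * Cmod (w - z)%C).
Proof.
  split.
  - intros [_ H] eps. specialize (H z (fun P HP => HP) eps).
    apply locally_C in H. eapply filter_imp; [|exact H]. intros w Hw.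
    rewrite (Cmult_comm l). exact Hw.
  - intros H; split; [apply is_linear_scal_l|].
    intros x Hx. apply (is_filter_lim_locally_unique (V := AbsRing_NormedModule C_AbsRing)) in Hx. subst x.
    intros eps. apply locally_C. eapply filter_imp; [|exact (H eps)]. intros w Hw.
    cbv beta in Hw. rewrite (Cmult_comm l) in Hw. exact Hw.
Qed.

(* Only real parts are needed: the imaginary part of [f] is the real part of [- i f]. *)
Lemma is_Cderive_filterdiff_Re (f : C -> C) (z l : C) : is_Cderive f z l ->
  filterdiff (K := R_AbsRing) (U := R2_NormedModule) (V := R_NormedModule)
    (fun w => Re (f w)) (locally z) (fun w => Re (l * w)%C).
Proof.
  intros H; split.
  - split.
    + intros x y. change (Re (l * (x + y))%C = Re (l * x)%C + Re (l * y)%C).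
      rewrite <- re_plus. f_equal; ring.
    + intros a x. change (Re (l * (a * Re x, a * Im x)%R)%C = a * Re (l * x)%C).
      rewrite !re_mult. simpl. ring.
    + exists (Cmod l + 1). assert (0 <= Cmod l) by apply Cmod_ge_0. split; [lra|].
      intros x. change (Rabs (Re (l * x)%C) <= (Cmod l + 1) * norm (V := R2_NormedModule) x).
      rewrite norm_prod_Cmod. eapply Rle_trans; [apply re_le_Cmod|]. rewrite Cmod_mult.
      generalize (Cmod_ge_0 x); nra.
  - intros x Hx. apply (is_filter_lim_locally_unique (V := R2_NormedModule)) in Hx.
    subst x. intros eps. eapply filter_imp; [|exact (proj1 (is_Cderive_iff f z l) H eps)].
    intros w Hw.
    change (Rabs (Re (f w) - Re (f z) - Re (l * (w - z))%C)
      <= eps * norm (V := R2_NormedModule) (w - z)%C).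
    rewrite norm_prod_Cmod. eapply Rle_trans; [|exact Hw].
    apply (re_le_Cmod (f w - f z - l * (w - z))%C).
Qed.

Lemma is_derive_Re_comp (f : C -> C) (l : C) (p q : R -> R) t dp dq :
  is_Cderive f (p t, q t) l -> is_derive p t dp -> is_derive q t dq ->
  is_derive (fun s => Re (f (p s, q s))) t (Re (l * (dp, dq))%C).
Proof.
  intros Hf Hp Hq. apply is_Cderive_filterdiff_Re in Hf.
  eapply filterdiff_ext_lin.
  - apply (filterdiff_comp'_2 p q (fun x y => Re (f (x, y))) t _ _ (fun x y => Re (l * (x, y))%C) Hp Hq).
    eapply filterdiff_ext_lin; [eapply filterdiff_ext; [|exact Hf]|]; now intros [x y].
  - intros y. change (Re (l * (y * dp, y * dq)%R)%C = y * Re (l * (dp, dq))%C).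
    rewrite !re_mult. simpl. ring.
Qed.

Lemma is_Cderive_Cauchy_Riemann (u v : R -> R -> R) (a b : R -> R -> R) (z : C) :
  (forall x y, is_derive (fun x => u x y) x (a x y)) ->
  (forall x y, is_derive (fun y => u x y) y (- b x y)) ->
  (forall x y, is_derive (fun x => v x y) x (b x y)) ->
  (forall x y, is_derive (fun y => v x y) y (a x y)) ->
  jointly_continuous a -> jointly_continuous b ->
  is_Cderive (fun w => (u (Re w) (Im w), v (Re w) (Im w))) z (a (Re z) (Im z), b (Re z) (Im z)).
Proof.
  intros ux uy vx vy Ca Cb. destruct z as [x y]. apply is_Cderive_iff; intros eps. simpl.
  assert (remainder : forall g gx gy : R -> R -> R,
    (forall x y, is_derive (fun x => g x y) x (gx x y)) ->
    (forall x y, is_derive (fun y => g x y) y (gy x y)) -> jointly_continuous gx ->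
    forall e : posreal, locally ((x, y) : C) (fun w =>
      Rabs (g (Re w) (Im w) - g x y - ((Re w - x) * gx x y + (Im w - y) * gy x y))
        <= e * Cmod (w - (x, y))%C)).
  { intros g gx gy Hx Hy Cx e.
    destruct (is_derive_filterdiff g x y gx (gy x y)) as [_ D]; auto.
    { apply filter_forall; auto. }
    eapply filter_imp; [|exact (D (x, y) (fun P HP => HP) e)]. intros w Hw.
    rewrite <- norm_prod_Cmod. exact Hw. }
  assert (He : 0 < eps / 2) by (generalize (cond_pos eps); lra).
  generalize (filter_and _ _ (remainder u a _ ux uy Ca (mkposreal _ He))
    (remainder v b _ vx vy Cb (mkposreal _ He))).
  apply filter_imp. intros w [Hu Hv]. simpl in Hu, Hv.
  eapply Rle_trans; [apply Cmod_le_Rabs_Re_Im|].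
  replace (eps * Cmod (w - (x, y))) with (eps / 2 * Cmod (w - (x, y)) + eps / 2 * Cmod (w - (x, y)))
    by field.
  apply Rplus_le_compat; [eapply Rle_trans; [|exact Hu]|eapply Rle_trans; [|exact Hv]];
    right; f_equal; unfold Re, Im; simpl; ring.
Qed.

Lemma is_Cderive_continuous (f f' : C -> C) :
  (forall z, is_Cderive f z (f' z)) -> continuous_fun f.
Proof.
  intros H z P HP. apply locally_C.
  exact (ex_derive_continuous (K := C_AbsRing) (V := C_NormedModule) f z (ex_intro _ _ (H z)) P HP).
Qed.

Lemma is_Cderive_Cmult_l (c : C) (f : C -> C) (z l : C) :
  is_Cderive f z l -> is_Cderive (fun w => (c * f w)%C) z (c * l)%C.
Proof.
  intros H. eapply filterdiff_ext_lin.
  - exact (filterdiff_scal_r_fct (K := C_AbsRing) (U := AbsRing_NormedModule C_AbsRing)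
      (V := C_NormedModule) c f _ Cmult_comm H).
  - intros w. change (c * (w * l) = w * (c * l))%C. ring.
Qed.

Lemma is_Cderive_comp_affine (f : C -> C) (a b z l : C) :
  is_Cderive f (a * z + b)%C l -> is_Cderive (fun w => f (a * w + b)%C) z (a * l)%C.
Proof.
  intros H.
  apply (is_derive_comp (K := C_AbsRing) (V := C_NormedModule) f (fun w => (a * w + b)%C)); [exact H|].
  assert (affine : is_derive (K := C_AbsRing) (V := AbsRing_NormedModule C_AbsRing)
    (fun w => plus (scal w a) b) z (plus (scal one a) zero))
    by exact (is_derive_plus (V := AbsRing_NormedModule C_AbsRing) _ _ z _ _
      (is_derive_scal_l (V := AbsRing_NormedModule C_AbsRing) _ z _ a (is_derive_id z))
      (is_derive_const (V := AbsRing_NormedModule C_AbsRing) b z)).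
  rewrite plus_zero_r, scal_one in affine. eapply is_derive_ext; [|exact affine].
  intros w. change (w * a + b = a * w + b)%C. ring.
Qed.

Lemma Cmod_segment_le (a b : C) t r : 0 <= t <= 1 -> Cmod a <= r -> Cmod b <= r ->
  Cmod (a + t * (b - a))%C <= r.
Proof.
  intros Ht Ha Hb. replace (a + t * (b - a))%C with ((1 - t)%R * a + t * b)%C
    by (rewrite RtoC_minus; ring).
  eapply Rle_trans; [apply Cmod_triangle|]. rewrite !Cmod_mult, !Cmod_R, !Rabs_pos_eq by lra. nra.
Qed.

(* The mean value theorem applied to the real part of [conj (f b - f a) * f] along the segment. *)
Lemma Cmod_mean_value (f f' : C -> C) (a b : C) M :
  (forall z, is_Cderive f z (f' z)) ->
  (forall t, 0 <= t <= 1 -> Cmod (f' (a + t * (b - a))%C) <= M) ->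
  Cmod (f b - f a)%C <= M * Cmod (b - a)%C.
Proof.
  intros Hf HM.
  set (u := Cconj (f b - f a)).
  set (p := fun t => Re a + t * (Re b - Re a)). set (q := fun t => Im a + t * (Im b - Im a)).
  assert (segment : forall t, @eq C (p t, q t) (a + t * (b - a))%C).
  { intros t; unfold p, q; destruct a, b; unfold RtoC, Cmult, Cminus, Cplus, Copp; simpl; f_equal; ring. }
  assert (derivative : forall t,
    is_derive (fun s => Re (u * f (p s, q s))%C) t (Re (u * f' (p t, q t) * (b - a))%C)).
  { intros t. replace (b - a)%C with ((Re b - Re a, Im b - Im a)%R : C) by (now destruct a, b).
    apply (is_derive_Re_comp (fun z => u * f z)%C); [now apply is_Cderive_Cmult_l| |];
      unfold p, q; auto_derive; auto; ring. }
  destruct (MVT_gen (fun s => Re (u * f (p s, q s))%C) 0 1 _ (fun t _ => derivative t)) as [t [Ht mvt]].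
  { intros t _. apply continuity_pt_filterlim, (ex_derive_continuous (fun s => Re (u * f (p s, q s))%C)).
    eexists; apply derivative. }
  rewrite Rmin_left, Rmax_right in Ht by lra.
  rewrite !segment in mvt.
  replace (a + 1 * (b - a))%C with b in mvt by ring. replace (a + 0 * (b - a))%C with a in mvt by ring.
  assert (square : Cmod (f b - f a)%C ^ 2 <= Cmod (f b - f a)%C * (M * Cmod (b - a)%C)).
  { replace (Cmod (f b - f a)%C ^ 2) with (Re (u * f b)%C - Re (u * f a)%C).
    - rewrite mvt, Rminus_0_r, Rmult_1_r. eapply Rle_trans; [apply Rle_abs|].
      eapply Rle_trans; [apply re_le_Cmod|]. rewrite !Cmod_mult. unfold u; rewrite Cmod_conj, Rmult_assoc.
      apply Rmult_le_compat_l; [apply Cmod_ge_0|]. apply Rmult_le_compat_r; [apply Cmod_ge_0|auto].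
    - rewrite Cmod2_alt. unfold u. rewrite !re_mult, re_conj, im_conj.
      unfold Cminus; rewrite !re_plus. destruct (f a), (f b); unfold Re, Im; simpl; ring. }
  destruct (Req_dec (Cmod (f b - f a)%C) 0) as [Hz|Hz].
  - rewrite Hz. apply Rmult_le_pos; [|apply Cmod_ge_0].
    eapply Rle_trans; [apply Cmod_ge_0|apply (HM 0); lra].
  - apply Rmult_le_reg_l with (Cmod (f b - f a)%C); [|lra].
    generalize (Cmod_ge_0 (f b - f a)%C); lra.
Qed.

(** * Locally uniform limits *)

Definition converges_on_discs (f : nat -> C -> C) (F : C -> C) : Prop :=
  forall (r : R) (eps : posreal),
    eventually (fun n => forall z, Cmod z <= r -> Cmod (f n z - F z)%C <= eps).

Lemma converges_on_discs_after (f : nat -> C -> C) F r (eps : posreal) n0 :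
  converges_on_discs f F ->
  exists k, (n0 <= k)%nat /\ forall z, Cmod z <= r -> Cmod (f k z - F z)%C <= eps.
Proof.
  intros H. destruct (H r eps) as [n Hn]. exists (max n0 n). split; [lia|]. apply Hn; lia.
Qed.

(* The increments of [F - f n] are the limits of those of [f k - f n], whose derivatives are at most [e]. *)
Lemma converges_on_discs_increment (f f' : nat -> C -> C) (F : C -> C) n r e z w :
  (forall n z, is_Cderive (f n) z (f' n z)) -> converges_on_discs f F ->
  (forall k y, (n <= k)%nat -> Cmod y <= r -> Cmod (f' k y - f' n y)%C <= e) ->
  Cmod z <= r -> Cmod w <= r ->
  Cmod ((F w - f n w) - (F z - f n z))%C <= e * Cmod (w - z)%C.
Proof.
  intros D L He Hz Hw. apply le_epsilon; intros x Hx.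
  assert (Hx2 : 0 < x / 2) by lra.
  destruct (converges_on_discs_after f F r (mkposreal _ Hx2) n L) as [k [Hk Lk]]. simpl in Lk.
  replace ((F w - f n w) - (F z - f n z))%C with
    (((f k w + - (1) * f n w) - (f k z + - (1) * f n z)) + ((f k z - F z) + - (f k w - F w)))%C by ring.
  eapply Rle_trans; [apply Cmod_triangle|]. apply Rplus_le_compat.
  - apply (Cmod_mean_value (fun y => f k y + - (1) * f n y)%C (fun y => f' k y + - (1) * f' n y)%C).
    + intros y. apply (is_derive_plus (K := C_AbsRing) (V := C_NormedModule)); [apply D|].
      apply is_Cderive_Cmult_l, D.
    + intros t Ht. set (y := (z + t * (w - z))%C).
      replace (f' k y + - (1) * f' n y)%C with (f' k y - f' n y)%C by ring.
      apply He; [exact Hk|now apply Cmod_segment_le].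
  - eapply Rle_trans; [apply Cmod_triangle|]. rewrite Cmod_opp.
    generalize (Lk z Hz) (Lk w Hw); lra.
Qed.

Lemma is_Cderive_limit (f f' : nat -> C -> C) (F F' : C -> C) :
  (forall n z, is_Cderive (f n) z (f' n z)) ->
  converges_on_discs f F -> converges_on_discs f' F' -> forall z, is_Cderive F z (F' z).
Proof.
  intros D L L' z. apply is_Cderive_iff; intros eps.
  assert (He : 0 < eps / 4) by (generalize (cond_pos eps); lra).
  set (e := mkposreal _ He). set (r := Cmod z + 1).
  destruct (L' r e) as [n Hn].
  generalize (filter_and _ _ (proj1 (is_Cderive_iff _ _ _) (D n z) e)
    (proj2 (locally_C z _) (locally_ball (T := AbsRing_UniformSpace C_AbsRing) z (mkposreal 1 Rlt_0_1)))).
  apply filter_imp. intros w [differentiable near].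
  change (Cmod (w - z)%C < 1) in near.
  assert (Hz : Cmod z <= r) by (unfold r; lra).
  assert (Hw : Cmod w <= r).
  { replace w with (z + (w - z))%C by ring. eapply Rle_trans; [apply Cmod_triangle|unfold r; lra]. }
  assert (increment : Cmod ((F w - f n w) - (F z - f n z))%C <= 2 * e * Cmod (w - z)%C).
  { apply (converges_on_discs_increment f f' F n r); auto. intros k y Hk Hy.
    replace (f' k y - f' n y)%C with ((f' k y - F' y) + - (f' n y - F' y))%C by ring.
    eapply Rle_trans; [apply Cmod_triangle|]. rewrite Cmod_opp.
    generalize (Hn k Hk y Hy) (Hn n (le_n n) y Hy); lra. }
  replace (F w - F z - F' z * (w - z))%C with
    (((F w - f n w) - (F z - f n z)) + (f n w - f n z - f' n z * (w - z))
      + (f' n z - F' z) * (w - z))%C by ring.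
  eapply Rle_trans; [apply Cmod_triangle|]. eapply Rle_trans; [apply Rplus_le_compat_r, Cmod_triangle|].
  rewrite (Cmod_mult _ (w - z)).
  assert (derivatives := Hn n (le_n n) z Hz).
  unfold e in *; simpl in *. generalize (Cmod_ge_0 (w - z)%C); nra.
Qed.

Lemma half_pow_pos n : 0 < (1/2)^n.
Proof. apply pow_lt; lra. Qed.

Lemma half_pow_decreasing k n : (k <= n)%nat -> (1/2)^n <= (1/2)^k.
Proof.
  intros H; induction H as [|n _ IH]; [lra|]. simpl. generalize (half_pow_pos n); lra.
Qed.

Lemma is_lim_seq_half_pow : is_lim_seq (fun n => (1/2)^n) 0.
Proof. apply is_lim_seq_geom; rewrite Rabs_pos_eq; lra. Qed.

Lemma half_pow_small eps : 0 < eps -> exists n, (1/2)^n <= eps.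
Proof.
  intros He.
  destruct (proj2 (is_lim_seq_spec _ _) is_lim_seq_half_pow (mkposreal eps He)) as [n Hn].
  exists n. specialize (Hn n (le_n n)). apply Rabs_def2 in Hn. simpl in Hn. lra.
Qed.

(* The sequences [u k - 2 / 2^k] and [u k + 2 / 2^k] are adjacent. *)
Lemma Lim_seq_geometric_error (u : nat -> R) n :
  (forall k, (n <= k)%nat -> Rabs (u (S k) - u k) <= (1/2)^k) ->
  Rabs (u n - Lim_seq u) <= 2 * (1/2)^n.
Proof.
  intros H.
  set (lo := fun k => u (k + n)%nat - 2 * (1/2)^(k + n)).
  set (hi := fun k => u (k + n)%nat + 2 * (1/2)^(k + n)).
  assert (lo_incr : forall k, lo k <= lo (S k)).
  { intros k. unfold lo. specialize (H (k + n)%nat ltac:(lia)). apply Rabs_le_between in H. simpl. lra. }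
  assert (hi_decr : forall k, hi (S k) <= hi k).
  { intros k. unfold hi. specialize (H (k + n)%nat ltac:(lia)). apply Rabs_le_between in H. simpl. lra. }
  assert (gap : is_lim_seq (fun k => 4 * (1/2)^(k + n)) 0).
  { replace (Finite 0) with (Rbar_mult 4 0) by (simpl; now rewrite Rmult_0_r).
    apply is_lim_seq_scal_l. now apply (is_lim_seq_incr_n (fun k => (1/2)^k) n 0), is_lim_seq_half_pow. }
  destruct (ex_lim_seq_adj lo hi) as [[l Hlo] [[l' Hhi] E]]; auto.
  { eapply is_lim_seq_ext; [|exact gap]. intros k; unfold lo, hi; simpl; field. }
  rewrite (is_lim_seq_unique _ _ Hlo), (is_lim_seq_unique _ _ Hhi) in E. injection E as <-.
  assert (Lu : is_lim_seq u l).
  { apply (is_lim_seq_incr_n u n l). apply (is_lim_seq_le_le lo _ hi); auto.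
    intros k. unfold lo, hi. generalize (half_pow_pos (k + n)); lra. }
  rewrite (is_lim_seq_unique _ _ Lu). simpl.
  assert (lo_le := is_lim_seq_incr_compare lo l Hlo lo_incr 0).
  assert (hi_ge := is_lim_seq_decr_compare hi l Hhi hi_decr 0).
  unfold lo, hi in lo_le, hi_ge. simpl in lo_le, hi_ge. apply Rabs_le. lra.
Qed.

Definition CLim_seq (u : nat -> C) : C :=
  (real (Lim_seq (fun n => Re (u n))), real (Lim_seq (fun n => Im (u n)))).

Lemma CLim_seq_geometric_error (u : nat -> C) n :
  (forall k, (n <= k)%nat -> Cmod (u (S k) - u k)%C <= (1/2)^k) ->
  Cmod (u n - CLim_seq u)%C <= 4 * (1/2)^n.
Proof.
  intros H. eapply Rle_trans; [apply Cmod_le_Rabs_Re_Im|].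
  assert (HRe : Rabs (Re (u n) - Lim_seq (fun k => Re (u k))) <= 2 * (1/2)^n).
  { apply (Lim_seq_geometric_error (fun k => Re (u k))). intros k Hk. eapply Rle_trans; [|apply (H k Hk)].
    apply (re_le_Cmod (u (S k) - u k)%C). }
  assert (HIm : Rabs (Im (u n) - Lim_seq (fun k => Im (u k))) <= 2 * (1/2)^n).
  { apply (Lim_seq_geometric_error (fun k => Im (u k))). intros k Hk. eapply Rle_trans; [|apply (H k Hk)].
    apply (Rabs_Im_le_Cmod (u (S k) - u k)%C). }
  change (Rabs (Re (u n) - Lim_seq (fun k => Re (u k))) + Rabs (Im (u n) - Lim_seq (fun k => Im (u k)))
    <= 4 * (1/2)^n). lra.
Qed.

(** * Jets and exponentials *)

Definition is_jet (F : nat -> C -> C) : Prop := forall m z, is_Cderive (F m) z (F (S m) z).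

Definition jet_plus (F G : nat -> C -> C) : nat -> C -> C := fun m z => (F m z + G m z)%C.

Lemma is_jet_plus F G : is_jet F -> is_jet G -> is_jet (jet_plus F G).
Proof. intros HF HG m z. now apply (is_derive_plus (K := C_AbsRing) (V := C_NormedModule)). Qed.

Lemma is_jet_zero : is_jet (fun _ _ => 0%C).
Proof. intros m z. apply (is_derive_const (K := C_AbsRing) (V := C_NormedModule)). Qed.

Lemma is_jet_limit (f : nat -> nat -> C -> C) :
  (forall n, is_jet (f n)) ->
  (forall n m z, (m <= n)%nat -> Cmod z <= INR n -> Cmod (f (S n) m z - f n m z)%C <= (1/2)^n) ->
  exists F, is_jet F /\
    forall n m z, (m <= n)%nat -> Cmod z <= INR n -> Cmod (f n m z - F m z)%C <= 4 * (1/2)^n.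
Proof.
  intros J H. exists (fun m z => CLim_seq (fun n => f n m z)).
  assert (error : forall n m z, (m <= n)%nat -> Cmod z <= INR n ->
    Cmod (f n m z - CLim_seq (fun n => f n m z))%C <= 4 * (1/2)^n).
  { intros n m z Hm Hz. apply (CLim_seq_geometric_error (fun n => f n m z)).
    intros k Hk. apply H; [lia|]. apply le_INR in Hk; lra. }
  split; [|exact error].
  assert (L : forall m, converges_on_discs (fun n => f n m) (fun z => CLim_seq (fun n => f n m z))).
  { intros m r eps. destruct (INR_unbounded r) as [n1 Hn1].
    assert (He : 0 < eps / 4) by (generalize (cond_pos eps); lra).
    destruct (half_pow_small _ He) as [n2 Hn2].
    exists (max m (max n1 n2)). intros n Hn z Hz.
    assert (INR n1 <= INR n) by (apply le_INR; lia).
    assert ((1/2)^n <= (1/2)^n2) by (apply half_pow_decreasing; lia).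
    eapply Rle_trans; [apply error; [lia|lra]|lra]. }
  intros m. apply (is_Cderive_limit (fun n => f n m) (fun n => f n (S m))); auto. intros n; apply J.
Qed.

Definition cexp (z : C) : C := pol (exp (Re z)) (Im z).

Lemma cexp_0 : cexp 0%C = 1%C.
Proof. unfold cexp, pol; simpl; rewrite exp_0, cos_0, sin_0. unfold RtoC; f_equal; ring. Qed.

Lemma Cmod_pol (s t : R) : 0 <= s -> Cmod (pol s t) = s.
Proof.
  intros Hs. apply Rsqr_inj; auto using Cmod_ge_0.
  rewrite !Rsqr_pow2, Cmod2_alt. unfold pol, Re, Im; simpl fst; simpl snd.
  replace (s ^ 2) with (s ^ 2 * (Rsqr (sin t) + Rsqr (cos t))) by (rewrite sin2_cos2; ring).
  unfold Rsqr; ring.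
Qed.

Lemma is_Cderive_cexp (z : C) : is_Cderive cexp z (cexp z).
Proof.
  apply (is_Cderive_Cauchy_Riemann (fun x y => exp x * cos y) (fun x y => exp x * sin y)
    (fun x y => exp x * cos y) (fun x y => exp x * sin y) z);
    try (intros x y; auto_derive; auto; ring); auto_continuous.
Qed.

Definition exp_jet (v : C) (N c : R) (m : nat) (z : C) : C :=
  (v * RtoC (N ^ m) * cexp (N * (z - c)))%C.

Lemma is_jet_exp v N c : is_jet (exp_jet v N c).
Proof.
  intros m z. unfold exp_jet.
  replace (v * RtoC (N ^ S m) * cexp (N * (z - c)))%C with
    (v * RtoC (N ^ m) * (N * cexp (N * z + - (N * c))))%C.
  - apply is_Cderive_Cmult_l.
    eapply is_derive_ext; [|apply is_Cderive_comp_affine, is_Cderive_cexp].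
    intros w; simpl. f_equal. ring.
  - simpl pow. rewrite RtoC_mult. replace (N * z + - (N * c))%C with (N * (z - c))%C by ring. ring.
Qed.

Lemma Cmod_exp_jet v N c m z : 0 <= N ->
  Cmod (exp_jet v N c m z) = Cmod v * N ^ m * exp (N * (Re z - c)).
Proof.
  intros HN. unfold exp_jet, cexp.
  rewrite !Cmod_mult, Cmod_R, Cmod_pol, Rabs_pos_eq by auto using pow_le, Rlt_le, exp_pos.
  f_equal. f_equal. destruct z; simpl; ring.
Qed.

Lemma exp_le x y : x <= y -> exp x <= exp y.
Proof. intros [H| ->]; [left; now apply exp_increasing|lra]. Qed.

Lemma pow_div_fact_le_exp n x : 0 <= x -> x ^ n / INR (fact n) <= exp x.
Proof.
  intros Hx. eapply Rle_trans; [|exact (exp_ge_taylor x n Hx)].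
  destruct n as [|n]; [simpl; lra|].
  assert (0 <= sum_f_R0 (fun k => x ^ k / INR (fact k)) n); [|simpl; lra].
  apply cond_pos_sum. intros k. apply Rmult_le_pos; [now apply pow_le|].
  apply Rlt_le, Rinv_0_lt_compat, INR_fact_lt_0.
Qed.

Lemma pow_mult_exp_small n c k eps : 0 <= c -> 0 < k -> 0 < eps ->
  exists N0, 1 <= N0 /\ forall N, N0 <= N -> c * N ^ n * exp (- (k * N)) <= eps.
Proof.
  intros Hc Hk He. set (B := c * INR (fact (S n)) / k ^ S n).
  assert (Hkn : 0 < k ^ S n) by now apply pow_lt.
  assert (Hf := INR_fact_lt_0 (S n)).
  assert (HB : 0 <= B / eps)
    by (repeat apply Rmult_le_pos; auto; try lra; now apply Rlt_le, Rinv_0_lt_compat).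
  exists (1 + B / eps). split; [lra|]. intros N HN.
  assert (Hexp := pow_div_fact_le_exp (S n) (k * N) ltac:(nra)).
  rewrite exp_Ropp. apply Rmult_le_reg_r with (exp (k * N)); [apply exp_pos|].
  rewrite Rmult_assoc, Rinv_l, Rmult_1_r by (apply Rgt_not_eq, exp_pos).
  apply Rle_trans with (eps * ((k * N) ^ S n / INR (fact (S n)))); [|apply Rmult_le_compat_l; lra].
  assert (BN : B <= eps * N).
  { replace B with (eps * (B / eps)) by (field; lra). apply Rmult_le_compat_l; lra. }
  assert (Hw : 0 <= N ^ n * (k ^ S n / INR (fact (S n)))).
  { repeat apply Rmult_le_pos; try (apply pow_le; lra); lra || now apply Rlt_le, Rinv_0_lt_compat. }
  replace (c * N ^ n) with (B * (N ^ n * (k ^ S n / INR (fact (S n))))).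
  - replace (eps * ((k * N) ^ S n / INR (fact (S n))))
      with (eps * N * (N ^ n * (k ^ S n / INR (fact (S n))))).
    + now apply Rmult_le_compat_r.
    + rewrite Rpow_mult_distr. simpl (N ^ S n). field; lra.
  - unfold B. field; split; lra.
Qed.

Lemma exp_jet_small v k eps r n : 0 < k -> 0 < eps ->
  exists N0, forall N m z, N0 <= N -> (m <= n)%nat -> Cmod z <= r ->
    Cmod (exp_jet v N (r + k) m z) <= eps.
Proof.
  intros Hk He. destruct (pow_mult_exp_small n (Cmod v) k eps (Cmod_ge_0 v) Hk He) as [N0 [N0_ge1 HN]].
  exists N0. intros N m z H Hm Hz. rewrite Cmod_exp_jet by lra.
  eapply Rle_trans; [|apply (HN N H)].
  assert (Re z <= r) by (generalize (re_le_Cmod z) (Rle_abs (Re z)); lra).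
  apply Rmult_le_compat.
  - apply Rmult_le_pos; [apply Cmod_ge_0|apply pow_le; lra].
  - apply Rlt_le, exp_pos.
  - apply Rmult_le_compat_l; [apply Cmod_ge_0|]. apply Rle_pow; auto; lra.
  - apply exp_le. nra.
Qed.

(** * Area and length functionals *)

Lemma RInt_gt_0_at (f : R -> R) a b x : continuous_fun f -> a < b -> a <= x <= b ->
  (forall y, a <= y <= b -> 0 <= f y) -> 0 < f x -> 0 < RInt f a b.
Proof.
  intros Hf Hab Hx Hpos Hfx.
  destruct (proj1 (filterlim_locally _ _) (Hf x) (mkposreal _ Hfx)) as [d Hd].
  set (c := Rmax a (x - d)). set (c' := Rmin b (x + d)).
  assert (d_pos := cond_pos d).
  assert (sub : a <= c /\ x - d <= c /\ c < c' /\ c' <= b /\ c' <= x + d).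
  { unfold c, c', Rmax, Rmin. destruct (Rle_dec a (x - d)), (Rle_dec b (x + d)); lra. }
  assert (integrable : forall u v, ex_RInt f u v) by (intros; now apply ex_RInt_continuous_fun).
  rewrite <- (RInt_Chasles (V := R_CompleteNormedModule) f a c b) by auto.
  rewrite <- (RInt_Chasles (V := R_CompleteNormedModule) f c c' b) by auto.
  change (0 < RInt f a c + (RInt f c c' + RInt f c' b)).
  assert (0 <= RInt f a c) by (apply RInt_ge_0; auto; [lra|intros; apply Hpos; lra]).
  assert (0 <= RInt f c' b) by (apply RInt_ge_0; auto; [lra|intros; apply Hpos; lra]).
  assert (0 < RInt f c c'); [|lra].
  apply RInt_gt_0; auto; [lra|]. intros y Hy.
  assert (Hball : ball x d y) by (apply Rabs_def1; unfold minus, plus, opp; simpl; lra).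
  specialize (Hd y Hball). apply Rabs_def2 in Hd. unfold minus, plus, opp in Hd; simpl in Hd. lra.
Qed.

Definition circle_integral (h : C -> R) (s : R) : R := RInt (fun th => h (pol s th) * s) 0 (2 * PI).
Definition disc_integral (h : C -> R) (t : R) : R := RInt (circle_integral h) 0 t.
Definition log_integral (F : R -> R) (r : R) : R := RInt (fun t => F t / t) 0 r.

Lemma two_PI_pos : 0 < 2 * PI.
Proof. generalize PI_RGT_0; lra. Qed.

Lemma circle_integral_continuous (h : C -> R) : continuous_fun h -> continuous_fun (circle_integral h).
Proof.
  intros H. apply (continuous_RInt_param (fun s th => h (pol s th) * s)).
  - auto_continuous.
  - apply Rlt_le, two_PI_pos.
Qed.

Lemma circular_mean_continuous (h : C -> R) : continuous_fun h ->
  continuous_fun (fun s : R => RInt (fun th => h (pol s th)) 0 (2 * PI) : R).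
Proof.
  intros H. apply (continuous_RInt_param (fun s th => h (pol s th))).
  - auto_continuous.
  - apply Rlt_le, two_PI_pos.
Qed.

Lemma circle_integral_scal_mean (h : C -> R) s : continuous_fun h ->
  circle_integral h s = s * RInt (fun th => h (pol s th)) 0 (2 * PI).
Proof.
  intros H. unfold circle_integral.
  rewrite <- (RInt_scal (V := R_CompleteNormedModule) (fun th => h (pol s th))).
  - apply RInt_ext; intros; apply Rmult_comm.
  - apply ex_RInt_continuous_fun; auto_continuous.
Qed.

Lemma RInt_is_derive (f : R -> R) a x : continuous_fun f -> is_derive (fun y => RInt f a y) x (f x).
Proof.
  intros Hf. apply (is_derive_RInt f (fun y => RInt f a y) a x); [|apply Hf].
  apply filter_forall; intros y.
  now apply (RInt_correct (V := R_CompleteNormedModule) f a y), ex_RInt_continuous_fun.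
Qed.

Lemma disc_integral_0 h : disc_integral h 0 = 0.
Proof. apply (RInt_point (V := R_CompleteNormedModule)). Qed.

(* At [t = 0] the quotient is the junk value [0 * / 0 = 0], which is also its limit. *)
Lemma disc_integral_div_continuous (h : C -> R) :
  continuous_fun h -> continuous_fun (fun t => disc_integral h t / t).
Proof.
  intros H t.
  assert (D : forall x, is_derive (disc_integral h) x (circle_integral h x))
    by (intros x; now apply RInt_is_derive, circle_integral_continuous).
  destruct (Req_dec t 0) as [->|Ht].
  - assert (D0 := proj1 (is_derive_Reals _ _ _) (D 0)).
    rewrite circle_integral_scal_mean, Rmult_0_l in D0 by auto.
    apply filterlim_locally; intros eps. destruct (D0 eps (cond_pos eps)) as [d Hd].
    exists d. intros y Hy. change (Rabs (disc_integral h y / y - disc_integral h 0 / 0) < eps).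
    change (Rabs (y - 0) < d) in Hy.
    rewrite disc_integral_0. unfold Rdiv at 2. rewrite Rmult_0_l.
    destruct (Req_dec y 0) as [->|Hy0].
    + rewrite disc_integral_0. unfold Rdiv. rewrite Rmult_0_l, Rminus_diag, Rabs_R0. apply cond_pos.
    + rewrite Rminus_0_r in Hy. specialize (Hd y Hy0 Hy).
      rewrite Rplus_0_l, disc_integral_0, !Rminus_0_r in Hd. now rewrite Rminus_0_r.
  - apply (continuous_mult (K := R_AbsRing)).
    + apply (ex_derive_continuous (disc_integral h)). eexists; apply D.
    + now apply continuous_Rinv.
Qed.

Lemma circle_integral_div_integrable (h : C -> R) r :
  continuous_fun h -> ex_RInt (fun t => circle_integral h t / t) 0 r.
Proof.
  intros H. apply (ex_RInt_ext (fun t => RInt (fun th => h (pol t th)) 0 (2 * PI))).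
  - intros t Ht. assert (Ht0 : t <> 0) by (unfold Rmin, Rmax in Ht; destruct (Rle_dec 0 r); lra).
    assert (mean : circle_integral h t / t = RInt (fun th => h (pol t th)) 0 (2 * PI))
      by (rewrite circle_integral_scal_mean by auto; now field_simplify).
    now symmetry.
  - now apply ex_RInt_continuous_fun, circular_mean_continuous.
Qed.

Record positive_functional (r : R) (L : (C -> R) -> R) : Prop := {
  functional_plus : forall f g : C -> R, continuous_fun f -> continuous_fun g ->
    L (fun z => f z + g z) = L f + L g;
  functional_scal : forall (c : R) (f : C -> R), continuous_fun f -> L (fun z => c * f z) = c * L f;
  functional_le : forall f g : C -> R, continuous_fun f -> continuous_fun g ->
    (forall z, Cmod z <= r -> f z <= g z) -> L f <= L g }.

Lemma positive_functional_eval r z : Cmod z <= r -> positive_functional r (fun h => h z).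
Proof. intros Hz; split; auto. Qed.

Lemma positive_functional_mult r L c : 0 <= c -> positive_functional r L ->
  positive_functional r (fun h => L h * c).
Proof.
  intros Hc [Lp Ls Ll]. split.
  - intros f g Hf Hg. rewrite Lp by auto. ring.
  - intros a f Hf. rewrite Ls by auto. ring.
  - intros f g Hf Hg H. apply Rmult_le_compat_r; auto.
Qed.

Lemma positive_functional_weaken r r' L : r <= r' -> positive_functional r L -> positive_functional r' L.
Proof.
  intros Hr [Lp Ls Ll]. split; auto. intros f g Hf Hg H. apply Ll; auto. intros z Hz; apply H; lra.
Qed.

Lemma positive_functional_RInt r (L : (C -> R) -> R -> R) a b : a <= b ->
  (forall f, continuous_fun f -> ex_RInt (L f) a b) ->
  (forall t, a < t < b -> positive_functional r (fun h => L h t)) ->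
  positive_functional r (fun h => RInt (L h) a b).
Proof.
  intros Hab integrable HL.
  assert (HL' : forall t, Rmin a b < t < Rmax a b -> positive_functional r (fun h => L h t)).
  { intros t; rewrite Rmin_left, Rmax_right by auto; auto. }
  split.
  - intros f g Hf Hg. rewrite <- (RInt_plus (V := R_CompleteNormedModule)) by auto.
    apply RInt_ext; intros t Ht. now apply (functional_plus _ _ (HL' t Ht)).
  - intros c f Hf. rewrite <- (RInt_scal (V := R_CompleteNormedModule)) by auto.
    apply RInt_ext; intros t Ht. now apply (functional_scal _ _ (HL' t Ht)).
  - intros f g Hf Hg H. apply RInt_le; auto. intros t Ht. now apply (functional_le _ _ (HL t Ht)).
Qed.

Section PositiveFunctional.
Variables (r : R) (L : (C -> R) -> R).
Hypothesis HL : positive_functional r L.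

Lemma functional_ext (f g : C -> R) : continuous_fun f -> continuous_fun g ->
  (forall z, Cmod z <= r -> f z = g z) -> L f = L g.
Proof.
  intros Hf Hg H. apply Rle_antisym; apply (functional_le _ _ HL); auto; intros z Hz; rewrite H; auto; lra.
Qed.

Lemma functional_linear_combination (a b c : R) (f g h : C -> R) :
  continuous_fun f -> continuous_fun g -> continuous_fun h ->
  L (fun z => a * f z + b * g z + c * h z) = a * L f + b * L g + c * L h.
Proof.
  intros Hf Hg Hh.
  rewrite !(functional_plus _ _ HL), !(functional_scal _ _ HL) by auto_continuous. reflexivity.
Qed.

Lemma functional_nonneg (f : C -> R) : continuous_fun f -> (forall z, Cmod z <= r -> 0 <= f z) -> 0 <= L f.
Proof.
  intros Hf H. replace 0 with (0 * L f) by ring. rewrite <- (functional_scal _ _ HL) by auto.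
  apply (functional_le _ _ HL); auto; [auto_continuous|].
  intros z Hz. rewrite Rmult_0_l; auto.
Qed.

Lemma functional_abs_le (f g : C -> R) : continuous_fun f -> continuous_fun g ->
  (forall z, Cmod z <= r -> Rabs (f z) <= g z) -> Rabs (L f) <= L g.
Proof.
  intros Hf Hg H. apply Rabs_le. split.
  - replace (- L g) with (-1 * L g) by ring. rewrite <- (functional_scal _ _ HL) by auto.
    apply (functional_le _ _ HL); auto; [auto_continuous|].
    intros z Hz. specialize (H z Hz). apply Rabs_le_between in H. lra.
  - apply (functional_le _ _ HL); auto. intros z Hz. specialize (H z Hz). apply Rabs_le_between in H. lra.
Qed.
End PositiveFunctional.

Lemma circle_integral_positive r : 0 <= r -> positive_functional r (fun h => circle_integral h r).
Proof.
  intros Hr. apply (positive_functional_RInt r (fun h th => h (pol r th) * r)).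
  - apply Rlt_le, two_PI_pos.
  - intros f Hf; apply ex_RInt_continuous_fun; auto_continuous.
  - intros t _. apply positive_functional_mult, positive_functional_eval; auto. rewrite Cmod_pol; lra.
Qed.

Lemma disc_integral_positive r : 0 <= r -> positive_functional r (fun h => disc_integral h r).
Proof.
  intros Hr. apply (positive_functional_RInt r circle_integral); auto.
  - intros f Hf; now apply ex_RInt_continuous_fun, circle_integral_continuous.
  - intros t Ht. apply positive_functional_weaken with t; [lra|]. apply circle_integral_positive; lra.
Qed.

Lemma log_integral_positive r (L : (C -> R) -> R -> R) : 0 <= r ->
  (forall f, continuous_fun f -> ex_RInt (fun t => L f t / t) 0 r) ->
  (forall t, 0 < t -> positive_functional t (fun h => L h t)) ->
  positive_functional r (fun h => log_integral (L h) r).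
Proof.
  intros Hr integrable HL. apply (positive_functional_RInt r (fun h t => L h t / t)); auto.
  intros t Ht. apply positive_functional_mult; [apply Rlt_le, Rinv_0_lt_compat; lra|].
  apply positive_functional_weaken with t; [lra|]. apply HL; lra.
Qed.

Inductive averaging : Type := Ahlfors | Nevanlinna.

Definition average (k : averaging) (F : R -> R) (r : R) : R :=
  match k with Ahlfors => F r | Nevanlinna => log_integral F r end.

Definition area (k : averaging) (r : R) (h : C -> R) : R := average k (disc_integral h) r.
Definition boundary (k : averaging) (r : R) (h : C -> R) : R := average k (circle_integral h) r.

Lemma area_positive k r : 0 <= r -> positive_functional r (area k r).
Proof.
  intros Hr. destruct k; [now apply disc_integral_positive|]. apply log_integral_positive; auto.
  - intros f Hf; now apply ex_RInt_continuous_fun, disc_integral_div_continuous.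
  - intros t Ht; apply disc_integral_positive; lra.
Qed.

Lemma boundary_positive k r : 0 <= r -> positive_functional r (boundary k r).
Proof.
  intros Hr. destruct k; [now apply circle_integral_positive|]. apply log_integral_positive; auto.
  - intros f Hf; now apply circle_integral_div_integrable.
  - intros t Ht; apply circle_integral_positive; lra.
Qed.

Lemma area_le_boundary k (F G : C -> R) K r : continuous_fun F -> continuous_fun G -> 0 <= r ->
  (forall t, 0 <= t -> Rabs (disc_integral F t) <= K * circle_integral G t) ->
  Rabs (area k r F) <= K * boundary k r G.
Proof.
  intros HF HG Hr H. destruct k; [now apply H|].
  assert (cF := disc_integral_div_continuous F HF). assert (iG := circle_integral_div_integrable G r HG).
  eapply Rle_trans; [apply abs_RInt_le; [auto|now apply ex_RInt_continuous_fun]|].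
  unfold boundary, average, log_integral.
  rewrite <- (RInt_scal (V := R_CompleteNormedModule)) by auto.
  apply RInt_le; auto.
  - apply ex_RInt_continuous_fun; auto_continuous.
  - now apply (ex_RInt_scal (V := R_NormedModule)).
  - intros t Ht. change (Rabs (disc_integral F t / t) <= K * (circle_integral G t / t)).
    unfold Rdiv. rewrite Rabs_mult, (Rabs_pos_eq (/ t)), <- Rmult_assoc
      by (apply Rlt_le, Rinv_0_lt_compat; lra).
    apply Rmult_le_compat_r; [apply Rlt_le, Rinv_0_lt_compat; lra|apply H; lra].
Qed.

Lemma area_gt_0 k (h : C -> R) r :
  continuous_fun h -> (forall z, 0 <= h z) -> 0 < r -> 0 < h (RtoC r) -> 0 < area k r h.
Proof.
  intros Hc Hn Hr Hp.
  assert (circle_ge : forall s, 0 <= s -> 0 <= circle_integral h s).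
  { intros s Hs. apply (functional_nonneg s (fun h => circle_integral h s)); auto.
    now apply circle_integral_positive. }
  assert (disc_ge : forall t, 0 <= t -> 0 <= disc_integral h t).
  { intros t Ht. apply (functional_nonneg t (fun h => disc_integral h t)); auto.
    now apply disc_integral_positive. }
  assert (circle_gt : 0 < circle_integral h r).
  { apply (RInt_gt_0_at _ _ _ 0); try (generalize two_PI_pos; lra).
    - auto_continuous.
    - intros; apply Rmult_le_pos; [apply Hn|lra].
    - apply Rmult_lt_0_compat; auto.
      replace (pol r 0) with (RtoC r) by (unfold pol, RtoC; rewrite cos_0, sin_0; f_equal; ring).
      exact Hp. }
  assert (disc_gt : 0 < disc_integral h r).
  { apply (RInt_gt_0_at _ _ _ r); try lra.
    - now apply circle_integral_continuous.
    - intros; apply circle_ge; lra. }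
  destruct k; [exact disc_gt|].
  apply (RInt_gt_0_at _ _ _ r); try lra.
  - now apply disc_integral_div_continuous.
  - intros t Ht. destruct (Req_dec t 0) as [->|Ht0].
    + rewrite disc_integral_0. unfold Rdiv. rewrite Rmult_0_l. lra.
    + apply Rmult_le_pos; [apply disc_ge; lra|apply Rlt_le, Rinv_0_lt_compat; lra].
  - now apply Rdiv_lt_0_compat.
Qed.

(** * Green's formula in polar coordinates *)

(* [RInt_ext] leaves equalities in the carrier of a normed module, which [ring] does not recognize. *)
Ltac ring_R := lazymatch goal with |- ?a = ?b => change (a = b :> R); ring end.

Lemma is_derive_Rmult (f g : R -> R) x df dg : is_derive f x df -> is_derive g x dg ->
  is_derive (fun t => f t * g t) x (df * g x + f x * dg).
Proof. intros Hf Hg. apply (is_derive_mult f g); auto. intros; apply Rmult_comm. Qed.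

Lemma is_derive_comp_2 (b b1 b2 : R -> R -> R) (x y : R -> R) t dx dy :
  (forall x y, is_derive (fun x => b x y) x (b1 x y)) ->
  (forall x y, is_derive (fun y => b x y) y (b2 x y)) -> jointly_continuous b1 ->
  is_derive x t dx -> is_derive y t dy ->
  is_derive (fun t => b (x t) (y t)) t (b1 (x t) (y t) * dx + b2 (x t) (y t) * dy).
Proof.
  intros Db1 Db2 Cb1 Hx Hy.
  assert (D : filterdiff (fun u : R * R => b (fst u) (snd u)) (locally (x t, y t))
    (fun u : R * R => plus (scal (fst u) (b1 (x t) (y t))) (scal (snd u) (b2 (x t) (y t))))).
  { apply (is_derive_filterdiff b (x t) (y t) b1 (b2 (x t) (y t))); auto. apply filter_forall; auto. }
  eapply filterdiff_ext_lin.
  - exact (filterdiff_comp'_2 x y b t _ _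
      (fun u v => plus (scal u (b1 (x t) (y t))) (scal v (b2 (x t) (y t)))) Hx Hy D).
  - intros s. unfold plus, scal; simpl; unfold mult; simpl. ring.
Qed.

Lemma is_derive_RInt_parameter (f df : R -> R -> R) a b s :
  (forall s t, is_derive (fun s => f s t) s (df s t)) -> jointly_continuous df ->
  (forall s, continuous_fun (f s)) ->
  is_derive (fun s => RInt (f s) a b) s (RInt (df s) a b).
Proof.
  intros Hdf Cdf Cf.
  rewrite <- (RInt_ext (fun t => Derive (fun u => f u t) s)).
  - apply is_derive_RInt_param.
    + apply filter_forall; intros x t _. exists (df x t); apply Hdf.
    + intros t _. apply (continuity_2d_pt_ext df).
      * intros x y; symmetry; now apply is_derive_unique.
      * apply continuity_2d_pt_filterlim. apply (Cdf (s, t)).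
    + apply filter_forall; intros y. now apply ex_RInt_continuous_fun.
  - intros t _. now apply is_derive_unique.
Qed.

Lemma RInt_derivative (f df : R -> R) a b :
  (forall x, is_derive f x (df x)) -> continuous_fun df -> RInt df a b = f b - f a :> R.
Proof.
  intros D Cdf. apply is_RInt_unique, (is_RInt_derive (V := R_CompleteNormedModule) f df); auto.
Qed.

Lemma RInt_eq_0 (f : R -> R) a b : (forall x, Rmin a b < x < Rmax a b -> f x = 0) -> RInt f a b = 0 :> R.
Proof.
  intros H. rewrite (RInt_ext _ (fun _ => 0)) by exact H. rewrite RInt_const. apply Rmult_0_r.
Qed.

(* Differentiate [int b x_t dt] in [s] and subtract [int d/dt (b x_s) dt = 0]. *)
Lemma stokes_polar (b bs bt xs xt xst : R -> R -> R) (c r : R) :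
  (forall s t, is_derive (fun s => b s t) s (bs s t)) ->
  (forall s t, is_derive (fun t => b s t) t (bt s t)) ->
  (forall s t, is_derive (fun s => xt s t) s (xst s t)) ->
  (forall s t, is_derive (fun t => xs s t) t (xst s t)) ->
  jointly_continuous b -> jointly_continuous bs -> jointly_continuous bt ->
  jointly_continuous xs -> jointly_continuous xt -> jointly_continuous xst -> 0 <= c ->
  (forall s, b s c * xs s c = b s 0 * xs s 0) -> (forall t, xt 0 t = 0) ->
  RInt (fun s => RInt (fun t => bs s t * xt s t - bt s t * xs s t) 0 c) 0 r =
  RInt (fun t => b r t * xt r t) 0 c.
Proof.
  intros Db_s Db_t Dxt Dxs Cb Cbs Cbt Cxs Cxt Cxst Hc closed origin.
  assert (exact_term : forall s, RInt (fun t => bt s t * xs s t + b s t * xst s t) 0 c = 0 :> R).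
  { intros s. rewrite (RInt_derivative (fun t => b s t * xs s t)).
    - rewrite closed; ring.
    - intros t; now apply is_derive_Rmult.
    - auto_continuous. }
  assert (D : forall s, is_derive (fun s => RInt (fun t => b s t * xt s t) 0 c) s
    (RInt (fun t => bs s t * xt s t - bt s t * xs s t) 0 c)).
  { intros s. replace (RInt (fun t => bs s t * xt s t - bt s t * xs s t) 0 c) with
      (RInt (fun t => bs s t * xt s t + b s t * xst s t) 0 c).
    - apply (is_derive_RInt_parameter (fun s t => b s t * xt s t)
        (fun s t => bs s t * xt s t + b s t * xst s t)).
      + intros s' t. now apply (is_derive_Rmult (fun s => b s t) (fun s => xt s t)).
      + auto_continuous.
      + intros s'. auto_continuous.
    - transitivity (RInt (fun t => bs s t * xt s t + b s t * xst s t) 0 c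
        - RInt (fun t => bt s t * xs s t + b s t * xst s t) 0 c).
      { rewrite exact_term. symmetry; apply Rminus_0_r. }
      symmetry; etransitivity; [|apply (RInt_minus (V := R_CompleteNormedModule));
        apply ex_RInt_continuous_fun; auto_continuous].
      apply RInt_ext. intros t _. unfold minus, plus, opp; simpl; ring. }
  rewrite (RInt_derivative _ _ _ _ D).
  - rewrite (RInt_eq_0 (fun t => b 0 t * xt 0 t)); [apply Rminus_0_r|].
    intros t _. rewrite origin; apply Rmult_0_r.
  - apply (continuous_RInt_param (fun s t => bs s t * xt s t - bt s t * xs s t));
      [auto_continuous|exact Hc].
Qed.

Lemma is_derive_Re_pol_s (f : C -> C) (l : C) s th : is_Cderive f (pol s th) l ->
  is_derive (fun s => Re (f (pol s th))) s (Re (l * pol 1 th)%C).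
Proof.
  intros H. apply (is_derive_Re_comp f l (fun s => s * cos th) (fun s => s * sin th)); auto;
    auto_derive; auto; ring.
Qed.

Lemma is_derive_Re_pol_th (f : C -> C) (l : C) s th : is_Cderive f (pol s th) l ->
  is_derive (fun th => Re (f (pol s th))) th (Re (l * (Ci * pol s th))%C).
Proof.
  intros H.
  replace (Ci * pol s th)%C with ((- s * sin th, s * cos th) : C)
    by (unfold pol, Ci, Cmult; simpl; f_equal; ring).
  apply (is_derive_Re_comp f l (fun th => s * cos th) (fun th => s * sin th)); auto;
    auto_derive; auto; ring.
Qed.

Section MixedDerivative.
Variables f f' : C -> C.
Hypothesis Hf : forall z, is_Cderive f z (f' z).

Let mixed (s th : R) : R :=
  Re (f' (pol s th) * pol 1 th * (Ci * pol s th) + f (pol s th) * (Ci * pol 1 th))%C.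

Lemma is_derive_pol_th_s (s th : R) :
  is_derive (fun s => Re (f (pol s th) * (Ci * pol s th))%C) s (mixed s th).
Proof.
  assert (DRe := is_derive_Re_pol_s f _ s th (Hf _)).
  assert (DIm := is_derive_Re_pol_s (fun z => Ci * f z)%C _ s th (is_Cderive_Cmult_l Ci _ _ _ (Hf _))).
  set (A := fun s => Re (f (pol s th))) in DRe. set (B := fun s => Re (Ci * f (pol s th))%C) in DIm.
  apply (is_derive_ext (fun s => s * (B s * cos th - A s * sin th))).
  - intros u. unfold A, B, pol. rewrite !re_mult, ?im_mult. unfold Re, Im, Ci; simpl. ring.
  - auto_derive; [repeat split; eexists; eassumption|].
    assert (derive_Re : Derive (fun u => A u) s = _) by exact (is_derive_unique A _ _ DRe).
    assert (derive_Im : Derive (fun u => B u) s = _) by exact (is_derive_unique B _ _ DIm).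
    rewrite derive_Re, derive_Im.
    unfold mixed, A, B, pol. rewrite re_plus, !re_mult, ?im_mult. unfold Re, Im, Ci; simpl. ring.
Qed.

Lemma is_derive_pol_s_th (s th : R) :
  is_derive (fun th => Re (f (pol s th) * pol 1 th)%C) th (mixed s th).
Proof.
  assert (DRe := is_derive_Re_pol_th f _ s th (Hf _)).
  assert (DIm := is_derive_Re_pol_th (fun z => Ci * f z)%C _ s th (is_Cderive_Cmult_l Ci _ _ _ (Hf _))).
  set (A := fun th => Re (f (pol s th))) in DRe. set (B := fun th => Re (Ci * f (pol s th))%C) in DIm.
  apply (is_derive_ext (fun th => A th * cos th + B th * sin th)).
  - intros u. unfold A, B, pol. rewrite !re_mult, ?im_mult. unfold Re, Im, Ci; simpl. ring.
  - auto_derive; [repeat split; eexists; eassumption|].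
    assert (derive_Re : Derive (fun u => A u) th = _) by exact (is_derive_unique A _ _ DRe).
    assert (derive_Im : Derive (fun u => B u) th = _) by exact (is_derive_unique B _ _ DIm).
    rewrite derive_Re, derive_Im.
    unfold mixed, A, B, pol. rewrite re_plus, !re_mult, ?im_mult. unfold Re, Im, Ci; simpl. ring.
Qed.
End MixedDerivative.

Definition twice_Cderivable (f f' : C -> C) : Prop :=
  (forall z, is_Cderive f z (f' z)) /\
  exists f'' : C -> C, (forall z, is_Cderive f' z (f'' z)) /\ continuous_fun f''.

Lemma twice_Cderivable_continuous (f f' : C -> C) :
  twice_Cderivable f f' -> continuous_fun f /\ continuous_fun f'.
Proof. intros [D [f'' [D' _]]]. split; eapply is_Cderive_continuous; eassumption. Qed.

Lemma twice_Cderivable_Cmult_l (c : C) (f f' : C -> C) :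
  twice_Cderivable f f' -> twice_Cderivable (fun z => c * f z)%C (fun z => c * f' z)%C.
Proof.
  intros [D [f'' [D' C'']]]. split; [intros z; now apply is_Cderive_Cmult_l|].
  exists (fun z => c * f'' z)%C. split; [intros z; now apply is_Cderive_Cmult_l|auto_continuous].
Qed.

Lemma polar_jacobian (u v : C) s th :
  Re (v * pol 1 th)%C * Re (u * (Ci * pol s th))%C - Re (v * (Ci * pol s th))%C * Re (u * pol 1 th)%C
    = Im (Cconj u * v)%C * s.
Proof.
  transitivity (Im (Cconj u * v)%C * s * (Rsqr (sin th) + Rsqr (cos th))); [|rewrite sin2_cos2; ring].
  destruct u, v. unfold pol, Ci, Cconj, Cmult, Re, Im, Rsqr; simpl. ring.
Qed.

Section Green.
Variables (f f' g g' : C -> C) (b b1 b2 : R -> R -> R).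
Hypothesis Hf : twice_Cderivable f f'.
Hypothesis Hg : twice_Cderivable g g'.
Hypothesis Hb1 : forall x y, is_derive (fun x => b x y) x (b1 x y).
Hypothesis Hb2 : forall x y, is_derive (fun y => b x y) y (b2 x y).
Hypothesis Cb : jointly_continuous b.
Hypothesis Cb1 : jointly_continuous b1.
Hypothesis Cb2 : jointly_continuous b2.

(* The pullback of [d (b dx)] under [(Re f, Re g)] has density [b2 * Im (conj f' * g')] up to sign. *)
Lemma green_formula t :
  disc_integral (fun z => b2 (Re (f z)) (Re (g z)) * Im (Cconj (f' z) * g' z)%C) t =
  RInt (fun th => b (Re (f (pol t th))) (Re (g (pol t th))) * Re (f' (pol t th) * (Ci * pol t th))%C)
    0 (2 * PI).
Proof.
  destruct (twice_Cderivable_continuous f f' Hf) as [Cf Cf'].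
  destruct (twice_Cderivable_continuous g g' Hg) as [Cg Cg'].
  destruct Hf as [Df [f'' [Df' Cf'']]]. destruct Hg as [Dg _].
  rewrite <- (stokes_polar (fun s th => b (Re (f (pol s th))) (Re (g (pol s th))))
    (fun s th => b1 (Re (f (pol s th))) (Re (g (pol s th))) * Re (f' (pol s th) * pol 1 th)%C
      + b2 (Re (f (pol s th))) (Re (g (pol s th))) * Re (g' (pol s th) * pol 1 th)%C)
    (fun s th => b1 (Re (f (pol s th))) (Re (g (pol s th))) * Re (f' (pol s th) * (Ci * pol s th))%C
      + b2 (Re (f (pol s th))) (Re (g (pol s th))) * Re (g' (pol s th) * (Ci * pol s th))%C)
    (fun s th => Re (f' (pol s th) * pol 1 th)%C)
    (fun s th => Re (f' (pol s th) * (Ci * pol s th))%C)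
    (fun s th => Re (f'' (pol s th) * pol 1 th * (Ci * pol s th) + f' (pol s th) * (Ci * pol 1 th))%C)).
  - apply RInt_ext; intros s _. apply RInt_ext; intros th _.
    rewrite Rmult_assoc, <- (polar_jacobian (f' (pol s th)) (g' (pol s th)) s th). ring_R.
  - intros s th. apply (is_derive_comp_2 b b1 b2); auto; apply is_derive_Re_pol_s; auto.
  - intros s th. apply (is_derive_comp_2 b b1 b2); auto; apply is_derive_Re_pol_th; auto.
  - intros s th. now apply is_derive_pol_th_s.
  - intros s th. now apply is_derive_pol_s_th.
  - auto_continuous.
  - auto_continuous.
  - auto_continuous.
  - auto_continuous.
  - auto_continuous.
  - auto_continuous.
  - apply Rlt_le, two_PI_pos.
  - intros s. unfold pol. now rewrite cos_2PI, sin_2PI, cos_0, sin_0.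
  - intros th. unfold pol. rewrite !Rmult_0_l. rewrite re_mult. unfold Re, Im; simpl; ring.
Qed.

Lemma green_bound M t : (forall x y, Rabs (b x y) <= M) -> 0 <= t ->
  Rabs (disc_integral (fun z => b2 (Re (f z)) (Re (g z)) * Im (Cconj (f' z) * g' z)%C) t)
    <= M * circle_integral (fun z => Cmod (f' z)) t.
Proof.
  intros HM Ht. rewrite green_formula.
  destruct (twice_Cderivable_continuous f f' Hf) as [Cf Cf'].
  destruct (twice_Cderivable_continuous g g' Hg) as [Cg _].
  assert (M0 : 0 <= M) by (eapply Rle_trans; [apply Rabs_pos|apply (HM 0 0)]).
  unfold circle_integral.
  eapply Rle_trans.
  { apply abs_RInt_le; [apply Rlt_le, two_PI_pos|apply ex_RInt_continuous_fun; auto_continuous]. }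
  rewrite <- (RInt_scal (V := R_CompleteNormedModule)) by (apply ex_RInt_continuous_fun; auto_continuous).
  apply RInt_le; [apply Rlt_le, two_PI_pos|apply ex_RInt_continuous_fun; auto_continuous| |].
  - apply (ex_RInt_scal (V := R_NormedModule)), ex_RInt_continuous_fun; auto_continuous.
  - intros th _. rewrite Rabs_mult. apply Rmult_le_compat; auto using Rabs_pos.
    eapply Rle_trans; [apply re_le_Cmod|]. rewrite !Cmod_mult, Cmod_Ci, Cmod_pol by exact Ht. lra.
Qed.
End Green.

(** * Length-area inequality on the torus *)

Lemma periodic_frac_part (u : R -> R) : (forall y, u (y + 1) = u y) -> forall y, u (frac_part y) = u y.
Proof.
  intros H.
  assert (Hnat : forall n y, u (y + INR n) = u y).
  { induction n as [|n IH]; intros y; [now rewrite Rplus_0_r|].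
    rewrite S_INR, <- Rplus_assoc, H; apply IH. }
  intros y. unfold frac_part. destruct (Z_le_gt_dec 0 (Int_part y)) as [Hn|Hn].
  - rewrite <- (Hnat (Z.to_nat (Int_part y))). f_equal. rewrite INR_IZR_INZ, Z2Nat.id by lia. ring.
  - rewrite <- (Hnat (Z.to_nat (- Int_part y)) y). f_equal.
    rewrite INR_IZR_INZ, Z2Nat.id, opp_IZR by lia. ring.
Qed.

Lemma frac_part_bounds y : 0 <= frac_part y <= 1.
Proof. destruct (base_fp y); lra. Qed.

Lemma RInt_0_1_bound (k : R -> R) M : continuous_fun k -> (forall x, Rabs (k x) <= M) ->
  Rabs (RInt k 0 1) <= M.
Proof.
  intros Hc HM. replace M with ((1 - 0) * M) by ring.
  apply abs_RInt_le_const; [lra|now apply ex_RInt_continuous_fun|auto].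
Qed.

Lemma primitive_periodic (k : R -> R) :
  continuous_fun k -> (forall x, k (x + 1) = k x) -> RInt k 0 1 = 0 :> R ->
  forall y, RInt k 0 (y + 1) = RInt k 0 y :> R.
Proof.
  intros Hc Hp mean0 y.
  rewrite <- (RInt_Chasles (V := R_CompleteNormedModule) k 0 1 (y + 1))
    by (now apply ex_RInt_continuous_fun).
  rewrite mean0. etransitivity; [apply Rplus_0_l|].
  assert (shift := RInt_comp_lin (V := R_CompleteNormedModule) k 1 1 0 y).
  rewrite Rmult_0_r, Rmult_1_l, Rplus_0_l in shift. rewrite <- shift by (now apply ex_RInt_continuous_fun).
  apply RInt_ext. intros x _. change (1 * k (1 * x + 1) = k x). now rewrite !Rmult_1_l, Hp.
Qed.

Lemma primitive_bounded (k : R -> R) M : continuous_fun k ->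
  (forall x, k (x + 1) = k x) -> RInt k 0 1 = 0 :> R -> (forall x, Rabs (k x) <= M) ->
  forall y, Rabs (RInt k 0 y) <= M.
Proof.
  intros Hc Hp mean0 HM y.
  assert (M0 : 0 <= M) by (eapply Rle_trans; [apply Rabs_pos|apply (HM 0)]).
  rewrite <- (periodic_frac_part (fun y => RInt k 0 y) (primitive_periodic k Hc Hp mean0) y).
  destruct (frac_part_bounds y).
  eapply Rle_trans; [|apply Rle_trans with ((frac_part y - 0) * M); [apply Rle_refl|nra]].
  apply abs_RInt_le_const; [lra|now apply ex_RInt_continuous_fun|auto].
Qed.

Lemma jointly_continuous_RInt (k : R -> R -> R) :
  jointly_continuous k -> jointly_continuous (fun x y => RInt (k x) 0 y : R).
Proof.
  intros Hk p.
  assert (rescale : forall q : R * R,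
    snd q * RInt (fun t => k (fst q) (snd q * t)) 0 1 = RInt (k (fst q)) 0 (snd q)).
  { intros [x y]; simpl.
    assert (scaling := RInt_comp_lin (V := R_CompleteNormedModule) (k x) y 0 0 1).
    rewrite Rmult_0_r, Rmult_1_r, !Rplus_0_r in scaling.
    rewrite <- scaling by (now apply ex_RInt_continuous_fun, jointly_continuous_slice).
    rewrite (RInt_scal (V := R_CompleteNormedModule)).
    - apply (f_equal (Rmult y)), RInt_ext. intros; now rewrite Rplus_0_r.
    - apply ex_RInt_continuous_fun. auto_continuous. }
  apply (continuous_ext _ _ _ rescale).
  assert (Hint : continuous_fun (fun q : R * R => RInt (fun t => k (fst q) (snd q * t)) 0 1 : R)).
  { apply (continuous_RInt_param (fun (q : R * R) t => k (fst q) (snd q * t))); [auto_continuous|lra]. }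
  auto_continuous.
Qed.

Definition torus_mean (f : R -> R -> R) : R := RInt (fun s => RInt (fun t => f s t) 0 1) 0 1.

(* [f - torus_mean f] is the sum of the partial derivatives of two bounded potentials, in [y] of
   [fiber_potential] and in [x] of [base_potential]. *)
Section TorusPotentials.
Variables (f fx : R -> R -> R) (M : R).
Hypothesis Cf : jointly_continuous f.
Hypothesis Cfx : jointly_continuous fx.
Hypothesis Hfx : forall x y, is_derive (fun x => f x y) x (fx x y).
Hypothesis period_x : forall x y, f (x + 1) y = f x y.
Hypothesis period_y : forall x y, f x (y + 1) = f x y.
Hypothesis f_bounded : forall x y, Rabs (f x y) <= M.

Let fiber_mean (x : R) : R := RInt (fun t => f x t) 0 1.
Let fiber_mean_x (x : R) : R := RInt (fun t => fx x t) 0 1.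
Let fiber_potential (x y : R) : R := RInt (fun t => f x t - fiber_mean x) 0 y.
Let base_potential (x : R) : R := RInt (fun s => fiber_mean s - torus_mean f) 0 x.

Lemma fiber_mean_continuous : continuous_fun fiber_mean.
Proof. apply (continuous_RInt_param f); [exact Cf|lra]. Qed.

Lemma fiber_mean_derive x : is_derive fiber_mean x (fiber_mean_x x).
Proof. apply (is_derive_RInt_parameter f fx); auto. intros s. now apply jointly_continuous_slice. Qed.

Lemma fiber_mean_bounded x : Rabs (fiber_mean x) <= M.
Proof. apply RInt_0_1_bound; auto. now apply (jointly_continuous_slice f). Qed.

Lemma RInt_sub_mean (k : R -> R) : continuous_fun k -> RInt (fun t => k t - RInt k 0 1) 0 1 = 0 :> R.
Proof.
  intros Ck. rewrite (RInt_minus (V := R_CompleteNormedModule))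
    by (apply ex_RInt_continuous_fun; auto_continuous).
  rewrite RInt_const. unfold minus, plus, opp, scal; simpl; unfold mult; simpl. ring_R.
Qed.

Lemma fiber_potential_bounded x y : Rabs (fiber_potential x y) <= 2 * M.
Proof.
  assert (Cfx' := jointly_continuous_slice f x Cf). assert (Bm := fiber_mean_bounded x).
  apply (primitive_bounded (fun t => f x t - fiber_mean x)).
  - auto_continuous.
  - intros t. now rewrite period_y.
  - now apply (RInt_sub_mean (f x)).
  - intros t. eapply Rle_trans; [apply Rabs_triang|]. rewrite Rabs_Ropp. specialize (f_bounded x t). lra.
Qed.

Lemma base_potential_bounded x : Rabs (base_potential x) <= 2 * M.
Proof.
  assert (Cm := fiber_mean_continuous).
  assert (Bm : Rabs (torus_mean f) <= M)
    by (apply (RInt_0_1_bound fiber_mean); auto using fiber_mean_bounded).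
  apply (primitive_bounded (fun s => fiber_mean s - torus_mean f)).
  - auto_continuous.
  - intros s. f_equal. unfold fiber_mean. apply RInt_ext; auto.
  - now apply (RInt_sub_mean fiber_mean).
  - intros s. eapply Rle_trans; [apply Rabs_triang|]. rewrite Rabs_Ropp.
    generalize (fiber_mean_bounded s); lra.
Qed.

Section Pullback.
Variables (u u' v v' : C -> C).
Hypothesis Hu : twice_Cderivable u u'.
Hypothesis Hv : twice_Cderivable v v'.

Lemma fiber_part_length_area t : 0 <= t ->
  Rabs (disc_integral (fun z =>
      (f (Re (u z)) (Re (v z)) - fiber_mean (Re (u z))) * Im (Cconj (u' z) * v' z)%C) t)
    <= 2 * M * circle_integral (fun z => Cmod (u' z)) t.
Proof.
  intros Ht. assert (Cm := fiber_mean_continuous).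
  assert (Cmx : continuous_fun fiber_mean_x) by (apply (continuous_RInt_param fx); [exact Cfx|lra]).
  assert (Ck : jointly_continuous (fun x y => f x y - fiber_mean x)) by auto_continuous.
  assert (Ckx : jointly_continuous (fun x y => fx x y - fiber_mean_x x)) by auto_continuous.
  apply (green_bound u u' v v' fiber_potential (fun x y => RInt (fun t => fx x t - fiber_mean_x x) 0 y)
    (fun x y => f x y - fiber_mean x)); auto using fiber_potential_bounded.
  - intros x y. apply (is_derive_RInt_parameter (fun x t => f x t - fiber_mean x)
      (fun x t => fx x t - fiber_mean_x x)); auto.
    + intros s r. apply (is_derive_minus (fun x => f x r) fiber_mean); auto using fiber_mean_derive.
    + intros s. exact (jointly_continuous_slice _ s Ck).
  - intros x y. apply (RInt_is_derive (fun t => f x t - fiber_mean x)).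
    exact (jointly_continuous_slice _ x Ck).
  - exact (jointly_continuous_RInt _ Ck).
  - exact (jointly_continuous_RInt _ Ckx).
Qed.

Lemma base_part_length_area t : 0 <= t ->
  Rabs (disc_integral (fun z => (fiber_mean (Re (u z)) - torus_mean f) * Im (Cconj (v' z) * u' z)%C) t)
    <= 2 * M * circle_integral (fun z => Cmod (v' z)) t.
Proof.
  intros Ht. assert (Cm := fiber_mean_continuous).
  apply (green_bound v v' u u' (fun _ x => base_potential x) (fun _ _ => 0)
    (fun _ x => fiber_mean x - torus_mean f)); auto using base_potential_bounded.
  - intros x y. apply (is_derive_const (K := R_AbsRing) (V := R_NormedModule)).
  - intros x y. apply (RInt_is_derive (fun s => fiber_mean s - torus_mean f)). auto_continuous.
  - apply (jointly_continuous_RInt (fun _ x => fiber_mean x - torus_mean f)). auto_continuous.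
  - auto_continuous.
  - auto_continuous.
Qed.
End Pullback.

Lemma torus_mean_decomposition (alpha beta : C) (h h' : C -> C) t :
  Im (Cconj alpha * beta)%C <> 0 -> continuous_fun h -> continuous_fun h' -> 0 <= t ->
  disc_integral (fun z =>
      (f (Re (alpha * h z)%C) (Re (beta * h z)%C) - torus_mean f) * Cmod (h' z) ^ 2) t =
  / Im (Cconj alpha * beta)%C *
    (disc_integral (fun z => (f (Re (alpha * h z)%C) (Re (beta * h z)%C) - fiber_mean (Re (alpha * h z)%C))
        * Im (Cconj (alpha * h' z) * (beta * h' z))%C) t
      + -1 * disc_integral (fun z => (fiber_mean (Re (alpha * h z)%C) - torus_mean f)
        * Im (Cconj (beta * h' z) * (alpha * h' z))%C) t).
Proof.
  intros Hd Ch Ch' Ht. assert (PD := disc_integral_positive t Ht). assert (Cm := fiber_mean_continuous).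
  rewrite <- (functional_scal _ _ PD (-1)), <- (functional_plus _ _ PD), <- (functional_scal _ _ PD)
    by auto_continuous.
  apply (functional_ext _ _ PD); [auto_continuous|auto_continuous|]. intros z _.
  replace (Im (Cconj (alpha * h' z) * (beta * h' z))%C) with (Im (Cconj alpha * beta)%C * Cmod (h' z) ^ 2)
    by (rewrite Cmod2_alt; destruct alpha, beta, (h' z); unfold Cconj, Cmult, Re, Im; simpl; ring).
  replace (Im (Cconj (beta * h' z) * (alpha * h' z))%C) with (- Im (Cconj alpha * beta)%C * Cmod (h' z) ^ 2)
    by (rewrite Cmod2_alt; destruct alpha, beta, (h' z); unfold Cconj, Cmult, Re, Im; simpl; ring).
  field. exact Hd.
Qed.

Lemma torus_length_area (alpha beta : C) : Im (Cconj alpha * beta)%C <> 0 ->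
  exists K, 0 <= K /\ forall h h' : C -> C, twice_Cderivable h h' -> forall t, 0 <= t ->
    Rabs (disc_integral (fun z =>
        (f (Re (alpha * h z)%C) (Re (beta * h z)%C) - torus_mean f) * Cmod (h' z) ^ 2) t)
      <= K * circle_integral (fun z => Cmod (h' z)) t.
Proof.
  intros Hd.
  assert (M0 : 0 <= M) by (eapply Rle_trans; [apply Rabs_pos|apply (f_bounded 0 0)]).
  assert (Hd' : 0 < / Rabs (Im (Cconj alpha * beta)%C)) by (now apply Rinv_0_lt_compat, Rabs_pos_lt).
  exists (/ Rabs (Im (Cconj alpha * beta)%C) * (2 * M * Cmod alpha + 2 * M * Cmod beta)). split.
  { generalize (Cmod_ge_0 alpha) (Cmod_ge_0 beta); intros.
    apply Rmult_le_pos; [lra|]. apply Rplus_le_le_0_compat; apply Rmult_le_pos; lra. }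
  intros h h' Hh t Ht.
  destruct (twice_Cderivable_continuous h h' Hh) as [Ch Ch'].
  assert (Halpha := twice_Cderivable_Cmult_l alpha h h' Hh).
  assert (Hbeta := twice_Cderivable_Cmult_l beta h h' Hh).
  assert (fiber_part := fiber_part_length_area _ _ _ _ Halpha Hbeta t Ht).
  assert (base_part := base_part_length_area _ _ _ _ Halpha Hbeta t Ht).
  assert (length_scal : forall c, circle_integral (fun z => Cmod (c * h' z)%C) t
    = Cmod c * circle_integral (fun z => Cmod (h' z)) t).
  { intros c. assert (PC := circle_integral_positive t Ht).
    rewrite <- (functional_scal _ _ PC) by auto_continuous.
    apply (functional_ext _ _ PC); [auto_continuous|auto_continuous|]. intros z _. apply Cmod_mult. }
  cbv beta in fiber_part, base_part. rewrite length_scal in fiber_part, base_part.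
  rewrite torus_mean_decomposition, Rabs_mult, Rabs_inv, Rmult_assoc by assumption.
  apply Rmult_le_compat_l; [lra|].
  eapply Rle_trans; [apply Rabs_triang|]. rewrite Rabs_mult, (Rabs_left (-1)) by lra. lra.
Qed.
End TorusPotentials.

(** * Periodic coefficients *)

Definition lattice_periodic {T : Type} (a1 b1 a2 b2 : C) (u : C * C -> T) : Prop :=
  forall (p : C * C) (g1 g2 : C), lattice a1 b1 g1 -> lattice a2 b2 g2 ->
    u ((fst p + g1)%C, (snd p + g2)%C) = u p.

Definition dual_fst (a b : C) : C := (Ci * Cconj b * (/ Im (Cconj a * b))%R)%C.
Definition dual_snd (a b : C) : C := (- (Ci * Cconj a * (/ Im (Cconj a * b))%R))%C.

Lemma dual_basis_decomposition (a b w : C) : nondeg a b ->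
  w = (Re (dual_fst a b * w)%C * a + Re (dual_snd a b * w)%C * b)%C.
Proof.
  unfold nondeg, dual_fst, dual_snd. destruct a as [a1 a2], b as [b1 b2], w as [w1 w2].
  unfold Im, Re, Ci, Copp, Cconj, Cmult, Cplus, RtoC; simpl. intros H. f_equal; field; lra.
Qed.

Lemma dual_basis_nondeg (a b : C) : nondeg a b -> nondeg (dual_fst a b) (dual_snd a b).
Proof.
  unfold nondeg. intros H.
  replace (Im (Cconj (dual_fst a b) * dual_snd a b)%C) with (- / Im (Cconj a * b)%C).
  - now apply Ropp_neq_0_compat, Rinv_neq_0_compat.
  - unfold dual_fst, dual_snd. destruct a as [a1 a2], b as [b1 b2]. revert H.
    unfold Im, Re, Ci, Copp, Cconj, Cmult, Cplus, RtoC; simpl. intros H. field; lra.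
Qed.

Lemma lattice_reduction (a b w : C) : nondeg a b ->
  exists g, lattice a b g /\ Cmod (w + g)%C <= Cmod a + Cmod b.
Proof.
  intros H. set (x := Re (dual_fst a b * w)%C). set (y := Re (dual_snd a b * w)%C).
  exists (IZR (- Int_part x) * a + IZR (- Int_part y) * b)%C. split; [now eexists; eexists|].
  replace (w + (IZR (- Int_part x) * a + IZR (- Int_part y) * b))%C
    with (frac_part x * a + frac_part y * b)%C.
  - eapply Rle_trans; [apply Cmod_triangle|]. rewrite !Cmod_mult, !Cmod_R.
    assert (Hx := frac_part_bounds x). assert (Hy := frac_part_bounds y).
    rewrite !Rabs_pos_eq by lra. generalize (Cmod_ge_0 a) (Cmod_ge_0 b); nra.
  - rewrite (dual_basis_decomposition a b w H) at 1. fold x y.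
    unfold frac_part. rewrite !RtoC_minus, !opp_IZR, !RtoC_opp. ring.
Qed.

Lemma lattice_0 a b : lattice a b 0%C.
Proof. exists 0%Z, 0%Z. ring. Qed.

Lemma lattice_fst a b : lattice a b a.
Proof. exists 1%Z, 0%Z. ring. Qed.

Lemma lattice_snd a b : lattice a b b.
Proof. exists 0%Z, 1%Z. ring. Qed.

Lemma pderiv_periodic a1 b1 a2 b2 u v :
  lattice_periodic a1 b1 a2 b2 u -> lattice_periodic a1 b1 a2 b2 (pderiv v u).
Proof.
  intros H p g1 g2 Hg1 Hg2. apply Derive_ext. intros t.
  rewrite <- (H (shiftR p v t) g1 g2 Hg1 Hg2). f_equal. unfold shiftR; simpl. f_equal; ring.
Qed.

Lemma pderiv_is_derive u v p t : (forall p, ex_derive (fun t => u (shiftR p v t)) 0) ->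
  is_derive (fun t => u (shiftR p v t)) t (pderiv v u (shiftR p v t)).
Proof.
  intros H. assert (D := Derive_correct _ _ (H (shiftR p v t))).
  rewrite <- (Rmult_1_l (pderiv v u _)).
  apply (is_derive_ext (fun s => u (shiftR (shiftR p v t) v (s - t)))).
  - intros s. f_equal. unfold shiftR; simpl. rewrite RtoC_minus. f_equal; ring.
  - apply (is_derive_comp (fun s => u (shiftR (shiftR p v t) v s)) (fun s => s - t)).
    + now rewrite Rminus_diag.
    + auto_derive; auto; ring.
Qed.

Lemma is_derive_snd_line u (e a w : C) x : Ck 1 u ->
  is_derive (fun x : R => u (e, (x * a + w)%C)) x
    (pderiv (RtoC 0, RtoC 1) u (e, (x * a + w)%C) * Re a
     + pderiv (RtoC 0, (0, 1) : C) u (e, (x * a + w)%C) * Im a).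
Proof.
  intros [_ Hu].
  destruct (Hu (RtoC 0, RtoC 1)) as [D1 [C1 _]]; [now right; right; left|].
  destruct (Hu (RtoC 0, (0, 1) : C)) as [D2 _]; [now right; right; right|].
  set (u1 := pderiv (RtoC 0, RtoC 1) u) in *. set (u2 := pderiv (RtoC 0, (0, 1) : C) u) in *.
  assert (partial1 : forall p q, is_derive (fun p => u (e, (p, q))) p (u1 (e, (p, q)))).
  { intros p q. assert (E : forall p, shiftR (e, (0, q)) (RtoC 0, RtoC 1) p = (e, (p, q))).
    { intros p'; destruct e; unfold shiftR, RtoC, Cplus, Cmult; simpl. f_equal; f_equal; ring. }
    rewrite <- E. eapply is_derive_ext; [|now apply pderiv_is_derive]. intros t; cbv beta; now rewrite E. }
  assert (partial2 : forall p q, is_derive (fun q => u (e, (p, q))) q (u2 (e, (p, q)))).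
  { intros p q. assert (E : forall q, shiftR (e, (p, 0)) (RtoC 0, (0, 1) : C) q = (e, (p, q))).
    { intros q'; destruct e; unfold shiftR, RtoC, Cplus, Cmult; simpl. f_equal; f_equal; ring. }
    rewrite <- E. eapply is_derive_ext; [|now apply pderiv_is_derive]. intros t; cbv beta; now rewrite E. }
  assert (line : forall x : R, ((x * Re a + Re w, x * Im a + Im w)%R : C) = (x * a + w)%C).
  { intros x'; destruct a, w; unfold RtoC, Cplus, Cmult; simpl. f_equal; ring. }
  apply (is_derive_ext (fun x => u (e, (x * Re a + Re w, x * Im a + Im w)%R))).
  { intros t. now rewrite line. }
  rewrite <- line.
  apply (is_derive_comp_2 (fun p q => u (e, (p, q))) (fun p q => u1 (e, (p, q))) (fun p q => u2 (e, (p, q)))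
    (fun x => x * Re a + Re w) (fun x => x * Im a + Im w)); auto; try (auto_derive; auto; ring).
  auto_continuous.
Qed.

Definition slice_mean (a b : C) (u : C * C -> R) (e : C) : R :=
  torus_mean (fun s t => u (e, (s * a + t * b)%C)).

Section PeriodicFunction.
Variables (a1 b1 a2 b2 : C) (u : C * C -> R).
Hypothesis nondeg1 : nondeg a1 b1.
Hypothesis nondeg2 : nondeg a2 b2.

Lemma lattice_periodic_bounded (v : C * C -> R) : continuous_fun v -> lattice_periodic a1 b1 a2 b2 v ->
  exists M, forall p, Rabs (v p) <= M.
Proof.
  intros Hc Hp.
  destruct (continuous_bounded_polydisc (fun p => Rabs (v p))
    (Rmax (Cmod a1 + Cmod b1) (Cmod a2 + Cmod b2))) as [M HM]; [auto_continuous|].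
  exists M. intros [z w].
  destruct (lattice_reduction a1 b1 z nondeg1) as [g1 [G1 Hg1]].
  destruct (lattice_reduction a2 b2 w nondeg2) as [g2 [G2 Hg2]].
  rewrite <- (Hp (z, w) g1 g2 G1 G2). apply HM; eauto using Rle_trans, Rmax_l, Rmax_r.
Qed.

Hypothesis Hu : Ck 1 u.
Hypothesis Hp : lattice_periodic a1 b1 a2 b2 u.

Lemma Lipschitz_direction v : coord_dir v ->
  exists K, 0 <= K /\ forall p t, Rabs (u (shiftR p v t) - u p) <= K * Rabs t.
Proof.
  intros Hv. destruct Hu as [_ Hu']. destruct (Hu' v Hv) as [D [C' _]].
  destruct (lattice_periodic_bounded (pderiv v u) C' (pderiv_periodic _ _ _ _ u v Hp)) as [K HK].
  exists K. split; [eapply Rle_trans; [apply Rabs_pos|apply (HK (RtoC 0, RtoC 0))]|].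
  intros p t.
  assert (B := bounded_variation (fun t => u (shiftR p v t)) (fun t => pderiv v u (shiftR p v t)) K 0 t).
  rewrite Rminus_0_r in B.
  replace (shiftR p v 0) with p in B.
  - apply B. intros s _. split; [now apply pderiv_is_derive|apply HK].
  - destruct p as [p1 p2]; unfold shiftR; simpl; f_equal; ring.
Qed.

Lemma Lipschitz_fst : exists K, 0 <= K /\
  forall z z' w, Rabs (u (z, w) - u (z', w)) <= K * Cmod (z - z')%C.
Proof.
  destruct (Lipschitz_direction (RtoC 1, RtoC 0)) as [Kx [Kx_ge0 Hx]]; [now left|].
  destruct (Lipschitz_direction ((0, 1) : C, RtoC 0)) as [Ky [Ky_ge0 Hy]]; [now right; left|].
  exists (Kx + Ky). split; [lra|]. intros z z' w.
  set (corner := (Re z, Im z') : C).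
  specialize (Hx (z', w) (Re z - Re z')). specialize (Hy (corner, w) (Im z - Im z')).
  replace (shiftR (z', w) _ _) with (corner, w) in Hx
    by (unfold corner; destruct z, z', w; unfold shiftR, RtoC, Cplus, Cmult; simpl; f_equal; f_equal; ring).
  replace (shiftR (corner, w) _ _) with (z, w) in Hy
    by (unfold corner; destruct z, z', w; unfold shiftR, RtoC, Cplus, Cmult; simpl; f_equal; f_equal; ring).
  replace (u (z, w) - u (z', w)) with ((u (z, w) - u (corner, w)) + (u (corner, w) - u (z', w))) by ring.
  eapply Rle_trans; [apply Rabs_triang|].
  assert (Re_le : Rabs (Re z - Re z') <= Cmod (z - z')%C) by apply (re_le_Cmod (z - z')%C).
  assert (Im_le : Rabs (Im z - Im z') <= Cmod (z - z')%C) by apply (Rabs_Im_le_Cmod (z - z')%C).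
  nra.
Qed.

Lemma slice_length_area e :
  exists K, 0 <= K /\ forall h h' : C -> C, twice_Cderivable h h' -> forall t, 0 <= t ->
    Rabs (disc_integral (fun z => (u (e, h z) - slice_mean a2 b2 u e) * Cmod (h' z) ^ 2) t)
      <= K * circle_integral (fun z => Cmod (h' z)) t.
Proof.
  assert (Cu : continuous_fun u) by exact (proj1 Hu).
  destruct (lattice_periodic_bounded u Cu Hp) as [M HM].
  destruct Hu as [_ Hu'].
  destruct (Hu' (RtoC 0, RtoC 1)) as [_ [C1 _]]; [now right; right; left|].
  destruct (Hu' (RtoC 0, (0, 1) : C)) as [_ [C2 _]]; [now right; right; right|].
  assert (shift : forall w g, lattice a2 b2 g -> u (e, (w + g)%C) = u (e, w)).
  { intros w g Hg. rewrite <- (Hp (e, w) 0%C g (lattice_0 _ _) Hg). simpl. f_equal. f_equal. ring. }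
  destruct (torus_length_area (fun x y => u (e, (x * a2 + y * b2)%C))
    (fun x y => pderiv (RtoC 0, RtoC 1) u (e, (x * a2 + y * b2)%C) * Re a2
      + pderiv (RtoC 0, (0, 1) : C) u (e, (x * a2 + y * b2)%C) * Im a2) M)
    with (alpha := dual_fst a2 b2) (beta := dual_snd a2 b2) as [K [K_ge0 HK]].
  - auto_continuous.
  - auto_continuous.
  - intros x y. now apply is_derive_snd_line.
  - intros x y. rewrite <- (shift (x * a2 + y * b2)%C a2 (lattice_fst _ _)).
    f_equal. f_equal. rewrite RtoC_plus. ring.
  - intros x y. rewrite <- (shift (x * a2 + y * b2)%C b2 (lattice_snd _ _)).
    f_equal. f_equal. rewrite RtoC_plus. ring.
  - intros x y; apply HM.
  - now apply dual_basis_nondeg.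
  - exists K. split; [exact K_ge0|]. intros h h' Hh t Ht.
    destruct (twice_Cderivable_continuous h h' Hh) as [Ch Ch'].
    rewrite (functional_ext _ _ (disc_integral_positive t Ht) _ (fun z =>
      (u (e, (Re (dual_fst a2 b2 * h z)%C * a2 + Re (dual_snd a2 b2 * h z)%C * b2)%C)
        - slice_mean a2 b2 u e) * Cmod (h' z) ^ 2)); [now apply HK|auto_continuous|auto_continuous|].
    intros z _. now rewrite <- dual_basis_decomposition.
Qed.
End PeriodicFunction.

(** * Concentrated curves and their currents *)

Definition density (g : curve) (z : C) : R := Cmod (dg1 g z) ^ 2 + Cmod (dg2 g z) ^ 2.

Definition twice_Cderivable_curve (g : curve) : Prop :=
  twice_Cderivable (g1 g) (dg1 g) /\ twice_Cderivable (g2 g) (dg2 g).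

(* On the disc of radius [r], most of the area lies close to the fiber over [e] and outweighs the
   boundary. *)
Definition concentrated (k : averaging) (r : R) (g : curve) (e : C) (eps : R) : Prop :=
  0 < area k r (density g) /\
  boundary k r (fun z => sqrt (density g z)) <= eps * area k r (density g) /\
  area k r (fun z => Cmod (dg1 g z) ^ 2) <= eps * area k r (density g) /\
  area k r (fun z => Cmod (g1 g z - e)%C * Cmod (dg2 g z) ^ 2) <= eps * area k r (density g).

Lemma curve_continuous g : twice_Cderivable_curve g ->
  continuous_fun (g1 g) /\ continuous_fun (g2 g) /\ continuous_fun (dg1 g) /\ continuous_fun (dg2 g).
Proof.
  intros [Hfst Hsnd].
  destruct (twice_Cderivable_continuous _ _ Hfst), (twice_Cderivable_continuous _ _ Hsnd). tauto.
Qed.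

Lemma density_continuous g : twice_Cderivable_curve g -> continuous_fun (density g).
Proof.
  intros Hg. destruct (curve_continuous g Hg) as [_ [_ [C1 C2]]]. unfold density. auto_continuous.
Qed.

Lemma Young_weighted a b t : 0 < t -> 2 * (a * b) <= / t * a ^ 2 + t * b ^ 2.
Proof.
  intros Ht. apply Rmult_le_reg_l with t; auto.
  replace (t * (/ t * a ^ 2 + t * b ^ 2)) with (a ^ 2 + (t * b) ^ 2) by (field; lra).
  generalize (pow2_ge_0 (a - t * b)). nra.
Qed.

Section ConcentratedEstimate.
Variables (u : C * C -> R) (e0 : C) (m M K1 K2 : R).
Hypothesis Cu : continuous_fun u.
Hypothesis M_ge0 : 0 <= M.
Hypothesis K1_ge0 : 0 <= K1.
Hypothesis K2_ge0 : 0 <= K2.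
Hypothesis u_Lipschitz : forall z z' w, Rabs (u (z, w) - u (z', w)) <= K1 * Cmod (z - z')%C.
Hypothesis u_length_area : forall h h' : C -> C, twice_Cderivable h h' -> forall t, 0 <= t ->
  Rabs (disc_integral (fun z => (u (e0, h z) - m) * Cmod (h' z) ^ 2) t)
    <= K2 * circle_integral (fun z => Cmod (h' z)) t.

Variables (k : averaging) (r : R) (g : curve) (e : C) (eps : R) (v : C -> R).
Hypothesis r_ge0 : 0 <= r.
Hypothesis Hg : twice_Cderivable_curve g.
Hypothesis eps_bounds : 0 < eps <= 1.
Hypothesis Hconc : concentrated k r g e eps.
Hypothesis Cv : continuous_fun v.
Hypothesis v_main_term : forall z, Rabs (v z - u (g1 g z, g2 g z) * Cmod (dg2 g z) ^ 2)
  <= M * (Cmod (dg1 g z) ^ 2 + 2 * (Cmod (dg1 g z) * Cmod (dg2 g z))).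

Let on_slice (z : C) : R := (u (e0, g2 g z) - m) * Cmod (dg2 g z) ^ 2.

Lemma deviation_from_slice t z : 0 < t ->
  Rabs (1 * v z + - m * density g z + -1 * on_slice z) <=
    (M + M * / t + Rabs m) * Cmod (dg1 g z) ^ 2 + (M * t + K1 * Cmod (e - e0)%C) * Cmod (dg2 g z) ^ 2
    + K1 * (Cmod (g1 g z - e)%C * Cmod (dg2 g z) ^ 2).
Proof.
  intros Ht. unfold on_slice, density. specialize (v_main_term z).
  set (P := Cmod (dg1 g z)) in *. set (Q := Cmod (dg2 g z)) in *.
  assert (Q2 := pow2_ge_0 Q). assert (P2 := pow2_ge_0 P).
  assert (Young : M * (2 * (P * Q)) <= M * (/ t * P ^ 2 + t * Q ^ 2))
    by (apply Rmult_le_compat_l; [exact M_ge0|now apply Young_weighted]).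
  assert (slice : Rabs (u (g1 g z, g2 g z) - u (e0, g2 g z)) * Q ^ 2
    <= K1 * (Cmod (g1 g z - e)%C + Cmod (e - e0)%C) * Q ^ 2).
  { apply Rmult_le_compat_r; auto. eapply Rle_trans; [apply u_Lipschitz|].
    apply Rmult_le_compat_l; auto.
    replace (g1 g z - e0)%C with ((g1 g z - e) + (e - e0))%C by ring. apply Cmod_triangle. }
  replace (1 * v z + - m * (P ^ 2 + Q ^ 2) + -1 * ((u (e0, g2 g z) - m) * Q ^ 2)) with
    ((v z - u (g1 g z, g2 g z) * Q ^ 2) + (u (g1 g z, g2 g z) - u (e0, g2 g z)) * Q ^ 2
      + - (m * P ^ 2)) by ring.
  eapply Rle_trans; [apply Rabs_triang|]. eapply Rle_trans; [apply Rplus_le_compat_r, Rabs_triang|].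
  rewrite Rabs_Ropp, !Rabs_mult, !(Rabs_pos_eq (_ ^ 2)) by apply pow2_ge_0.
  lra.
Qed.

Lemma slice_integral_small : Rabs (area k r on_slice) <= K2 * (eps * area k r (density g)).
Proof.
  destruct (curve_continuous g Hg) as [C1 [C2 [C1' C2']]]. destruct Hconc as [_ [Hlength _]].
  eapply Rle_trans; [apply (area_le_boundary k on_slice (fun z => Cmod (dg2 g z)) K2)|].
  - unfold on_slice; auto_continuous.
  - auto_continuous.
  - exact r_ge0.
  - apply u_length_area, Hg.
  - apply Rmult_le_compat_l; auto. eapply Rle_trans; [|exact Hlength].
    assert (Cd := density_continuous g Hg).
    apply (functional_le _ _ (boundary_positive k r r_ge0)); [auto_continuous|auto_continuous|].
    intros z _. rewrite <- (sqrt_pow2 (Cmod (dg2 g z))) by apply Cmod_ge_0.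
    apply sqrt_le_1_alt. unfold density. generalize (pow2_ge_0 (Cmod (dg1 g z))). lra.
Qed.

Lemma area_deviation t : 0 < t ->
  Rabs (area k r v - m * area k r (density g) - area k r on_slice)
    <= ((M + M * / t + Rabs m) * eps + (M * t + K1 * Cmod (e - e0)%C) + K1 * eps) * area k r (density g).
Proof.
  intros Ht.
  destruct (curve_continuous g Hg) as [C1 [C2 [C1' C2']]]. assert (Cd := density_continuous g Hg).
  assert (PL := area_positive k r r_ge0). destruct Hconc as [_ [_ [first_small off_small]]].
  set (first := fun z => Cmod (dg1 g z) ^ 2) in *. set (second := fun z => Cmod (dg2 g z) ^ 2).
  set (off := fun z => Cmod (g1 g z - e)%C * Cmod (dg2 g z) ^ 2) in *.
  assert (C_on : continuous_fun on_slice) by (unfold on_slice; auto_continuous).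
  assert (C_first : continuous_fun first) by (unfold first; auto_continuous).
  assert (C_second : continuous_fun second) by (unfold second; auto_continuous).
  assert (C_off : continuous_fun off) by (unfold off; auto_continuous).
  assert (second_le : area k r second <= area k r (density g)).
  { apply (functional_le _ _ PL); auto. intros z _. unfold second, density.
    generalize (pow2_ge_0 (Cmod (dg1 g z))). lra. }
  replace (area k r v - m * area k r (density g) - area k r on_slice)
    with (1 * area k r v + - m * area k r (density g) + -1 * area k r on_slice) by ring.
  rewrite <- (functional_linear_combination _ _ PL) by assumption.
  eapply Rle_trans.
  - apply (functional_abs_le _ _ PL _ (fun z => (M + M * / t + Rabs m) * first z
      + (M * t + K1 * Cmod (e - e0)%C) * second z + K1 * off z)); [auto_continuous|auto_continuous|].
    intros z _. now apply deviation_from_slice.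
  - rewrite (functional_linear_combination _ _ PL), !Rmult_plus_distr_r, !(Rmult_assoc _ eps) by assumption.
    assert (m_ge0 := Rabs_pos m). assert (c_ge0 := Cmod_ge_0 (e - e0)%C).
    assert (0 <= M * / t) by (apply Rmult_le_pos; [lra|now apply Rlt_le, Rinv_0_lt_compat]).
    assert (0 <= M * t + K1 * Cmod (e - e0)%C) by nra.
    assert (Hfirst : (M + M * / t + Rabs m) * area k r first
      <= (M + M * / t + Rabs m) * (eps * area k r (density g))) by (apply Rmult_le_compat_l; lra).
    assert (Hsecond : (M * t + K1 * Cmod (e - e0)%C) * area k r second
      <= (M * t + K1 * Cmod (e - e0)%C) * area k r (density g)) by now apply Rmult_le_compat_l.
    assert (Hoff : K1 * area k r off <= K1 * (eps * area k r (density g))) by now apply Rmult_le_compat_l.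
    lra.
Qed.

(* The weight in Young's inequality is [sqrt eps], which balances [eps / t] against [t]. *)
Lemma area_main_term :
  Rabs (area k r v - m * area k r (density g))
    <= (3 * M + Rabs m + K1 + K2) * (sqrt eps + Cmod (e - e0)%C) * area k r (density g).
Proof.
  assert (small := slice_integral_small).
  assert (A_gt0 : 0 < area k r (density g)) by apply Hconc. set (A := area k r (density g)) in *.
  assert (t_gt0 : 0 < sqrt eps) by (apply sqrt_lt_R0; lra).
  assert (deviation := area_deviation (sqrt eps) t_gt0). fold A in deviation.
  assert (t_sqr : sqrt eps * sqrt eps = eps) by (apply sqrt_sqrt; lra).
  assert (t_le1 : sqrt eps <= 1) by (rewrite <- sqrt_1; apply sqrt_le_1_alt; lra).
  set (t := sqrt eps) in *. set (c := Cmod (e - e0)%C) in *.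
  assert (c_ge0 : 0 <= c) by apply Cmod_ge_0. assert (m_ge0 := Rabs_pos m).
  replace (area k r v - m * A) with ((area k r v - m * A - area k r on_slice) + area k r on_slice) by ring.
  eapply Rle_trans; [apply Rabs_triang|].
  apply Rle_trans with (((M + M * / t + Rabs m) * eps + (M * t + K1 * c) + K1 * eps + K2 * eps) * A);
    [lra|].
  apply Rmult_le_compat_r; [lra|].
  replace ((M + M * / t + Rabs m) * eps) with ((M + Rabs m) * eps + M * t)
    by (rewrite <- t_sqr; field; lra).
  assert (eps_le : eps <= t) by nra.
  assert ((M + Rabs m + K1 + K2) * eps <= (M + Rabs m + K1 + K2) * t) by (apply Rmult_le_compat_l; lra).
  assert (0 <= (3 * M + Rabs m + K2) * c) by (apply Rmult_le_pos; lra).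
  lra.
Qed.
End ConcentratedEstimate.

Lemma is_Cderive_locally_const (f : C -> C) (c z l : C) :
  locally z (fun w => f w = c) -> is_Cderive f z l -> l = 0%C.
Proof.
  intros Hc H. apply locally_C in Hc.
  apply (is_derive_ext_loc (K := C_AbsRing) (V := C_NormedModule) f (fun _ => c)) in H; [|exact Hc].
  rewrite <- (is_C_derive_unique _ _ _ H).
  apply is_C_derive_unique, (is_derive_const (K := C_AbsRing) (V := C_NormedModule)).
Qed.

Lemma locally_Cmod_lt (z : C) r : Cmod z < r -> locally z (fun w => Cmod w < r).
Proof.
  intros Hz. assert (Hd : 0 < r - Cmod z) by lra.
  apply locally_C. exists (mkposreal _ Hd). intros w Hw.
  change (Cmod (w - z)%C < r - Cmod z) in Hw.
  replace w with (z + (w - z))%C by ring. eapply Rle_lt_trans; [apply Cmod_triangle|lra].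
Qed.

Lemma nonconst_on_of_area g r : 0 < r -> twice_Cderivable_curve g -> 0 < disc_integral (density g) r ->
  nonconst_on g r.
Proof.
  intros Hr [[D1 _] [D2 _]] HA. apply NNPP; intros Hconst.
  assert (const : forall w, Cmod w < r -> g1 g w = g1 g 0%C /\ g2 g w = g2 g 0%C).
  { intros w Hw. split; apply NNPP; intros H; apply Hconst; exists w; auto. }
  apply (Rlt_irrefl 0). rewrite <- (RInt_eq_0 (circle_integral (density g)) 0 r) at 2; [exact HA|].
  intros s Hs. rewrite Rmin_left, Rmax_right in Hs by lra.
  apply RInt_eq_0. intros th _.
  assert (near : locally (pol s th) (fun w => Cmod w < r))
    by (apply locally_Cmod_lt; rewrite Cmod_pol; lra).
  unfold density.
  rewrite (is_Cderive_locally_const (g1 g) (g1 g 0%C) (pol s th) (dg1 g (pol s th))),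
    (is_Cderive_locally_const (g2 g) (g2 g 0%C) (pol s th) (dg2 g (pol s th))); auto.
  - rewrite Cmod_0. ring.
  - eapply filter_imp; [|exact near]. intros w Hw; now apply const.
  - eapply filter_imp; [|exact near]. intros w Hw; now apply const.
Qed.

Definition Carea (k : averaging) (r : R) (h : C -> C) : C :=
  (area k r (fun z => Re (h z)), area k r (fun z => Im (h z))).

Definition normalized_current (k : averaging) (g : curve) (r : R) (eta : form11) : C :=
  (Carea k r (pull eta g) / area k r (density g))%C.

Definition produces_currents (k : averaging) (g : curve) (r : nat -> R) : Prop :=
  (forall l, nonconst_on g (r l)) /\
  is_lim_seq (fun l => boundary k (r l) (fun z => sqrt (density g z)) / area k (r l) (density g)) 0.

Definition limit_current (k : averaging) (a1 b1 a2 b2 : C) (g : curve) (r : nat -> R)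
    (T : form11 -> C) : Prop :=
  exists phi, subseq phi /\ forall eta, test_form a1 b1 a2 b2 eta ->
    filterlim (fun l => normalized_current k g (r (phi l)) eta) eventually (locally (T eta)).

Definition produces_multiples_of (a1 b1 a2 b2 : C) (g : curve) (r : nat -> R)
    (S : form11 -> C) : Prop :=
  forall k, produces_currents k g r /\
    forall T, limit_current k a1 b1 a2 b2 g r T -> positive_multiple a1 b1 a2 b2 T S.

Lemma image_current_Carea g r eta : image_current g r eta = Carea Ahlfors r (pull eta g).
Proof.
  unfold image_current, disc_int, CInt, Carea.
  f_equal; apply RInt_ext; intros s _; apply RInt_ext; intros th _; [apply re_scal_r|apply im_scal_r].
Qed.

Lemma Tnev_Carea g r eta : Tnev g r eta = Carea Nevanlinna r (pull eta g).
Proof.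
  unfold Tnev, CInt, Carea.
  f_equal; apply RInt_ext; intros t Ht; change (disc_int (pull eta g) t) with (image_current g t eta);
  rewrite image_current_Carea;
  (assert (t <> 0) by (unfold Rmin, Rmax in Ht; destruct (Rle_dec 0 r); lra));
  unfold Cdiv; rewrite <- RtoC_inv by assumption; [apply re_scal_r|apply im_scal_r].
Qed.

Lemma Cmult_Cconj_r (c d : C) : (c * d * Cconj d)%C = (c * (Cmod d ^ 2)%R)%C.
Proof. rewrite <- Cmult_assoc, <- Cmod2_conj, RtoC_pow. reflexivity. Qed.

Lemma pull_omega g z : pull omega g z = RtoC (density g z).
Proof.
  unfold pull, density; simpl c11; simpl c12; simpl c21; simpl c22.
  rewrite !Cmult_Cconj_r, RtoC_plus. ring.
Qed.

Lemma Re_Carea_omega k g r : Re (Carea k r (pull omega g)) = area k r (density g).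
Proof.
  change (area k r (fun z => Re (pull omega g z)) = area k r (density g)).
  f_equal. apply functional_extensionality; intros z. now rewrite pull_omega.
Qed.

Lemma produces_currents_nevanlinna g r : produces_currents Nevanlinna g r -> produces_nevanlinna g r.
Proof.
  intros [Hnonconst Hratio]. split; auto. eapply is_lim_seq_ext; [|exact Hratio].
  intros l; cbv beta. now rewrite Tnev_Carea, Re_Carea_omega.
Qed.

Lemma produces_currents_ahlfors g r : produces_currents Ahlfors g r -> produces_ahlfors g r.
Proof.
  intros [Hnonconst Hratio]. split; auto. eapply is_lim_seq_ext; [|exact Hratio].
  intros l; cbv beta. unfold Area. now rewrite image_current_Carea, Re_Carea_omega.
Qed.

Lemma limit_current_of_nevanlinna a1 b1 a2 b2 g r T :
  nevanlinna_current a1 b1 a2 b2 g r T -> limit_current Nevanlinna a1 b1 a2 b2 g r T.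
Proof.
  intros [phi [Hphi H]]. exists phi. split; auto. intros eta Heta.
  eapply filterlim_ext; [|exact (H eta Heta)].
  intros l; cbv beta. now rewrite !Tnev_Carea, Re_Carea_omega.
Qed.

Lemma limit_current_of_ahlfors a1 b1 a2 b2 g r T :
  ahlfors_current a1 b1 a2 b2 g r T -> limit_current Ahlfors a1 b1 a2 b2 g r T.
Proof.
  intros [phi [Hphi H]]. exists phi. split; auto. intros eta Heta.
  eapply filterlim_ext; [|exact (H eta Heta)].
  intros l; cbv beta. unfold Area. now rewrite !image_current_Carea, Re_Carea_omega.
Qed.

Lemma nevanlinna_ahlfors_multiples a1 b1 a2 b2 g r S : produces_multiples_of a1 b1 a2 b2 g r S ->
  produces_nevanlinna g r /\ produces_ahlfors g r /\
  (forall T, nevanlinna_current a1 b1 a2 b2 g r T -> positive_multiple a1 b1 a2 b2 T S) /\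
  (forall T, ahlfors_current a1 b1 a2 b2 g r T -> positive_multiple a1 b1 a2 b2 T S).
Proof.
  intros H. destruct (H Nevanlinna) as [PN CN], (H Ahlfors) as [PA CA].
  split; [now apply produces_currents_nevanlinna|]. split; [now apply produces_currents_ahlfors|].
  split; intros T HT; [now apply CN, limit_current_of_nevanlinna|now apply CA, limit_current_of_ahlfors].
Qed.

Lemma pull_main_term eta g M z :
  (forall p, Cmod (c11 eta p) <= M) -> (forall p, Cmod (c12 eta p) <= M) ->
  (forall p, Cmod (c21 eta p) <= M) ->
  Cmod (pull eta g z - c22 eta (g1 g z, g2 g z) * (Cmod (dg2 g z) ^ 2)%R)%C <=
    M * (Cmod (dg1 g z) ^ 2 + 2 * (Cmod (dg1 g z) * Cmod (dg2 g z))).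
Proof.
  intros H11 H12 H21. unfold pull. rewrite !Cmult_Cconj_r.
  set (p := (g1 g z, g2 g z)). specialize (H11 p); specialize (H12 p); specialize (H21 p).
  set (A := dg1 g z). set (B := dg2 g z).
  match goal with |- Cmod ?x <= _ => replace x with
    (c11 eta p * (Cmod A ^ 2)%R + c12 eta p * A * Cconj B + c21 eta p * B * Cconj A)%C by ring end.
  eapply Rle_trans; [apply Cmod_triangle|]. eapply Rle_trans; [apply Rplus_le_compat_r, Cmod_triangle|].
  rewrite !Cmod_mult, !Cmod_conj, Cmod_R, Rabs_pos_eq by apply pow2_ge_0.
  assert (HAB : 0 <= Cmod A * Cmod B) by (apply Rmult_le_pos; apply Cmod_ge_0).
  assert (HA := pow2_ge_0 (Cmod A)).
  generalize (Rmult_le_compat_r _ _ _ HA H11) (Rmult_le_compat_r _ _ _ HAB H12)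
    (Rmult_le_compat_r _ _ _ HAB H21).
  lra.
Qed.

Lemma is_lim_seq_0_dominated (u w : nat -> R) :
  (forall n, Rabs (u n) <= w n) -> is_lim_seq w 0 -> is_lim_seq u 0.
Proof.
  intros H Hw. apply is_lim_seq_abs_0.
  apply (is_lim_seq_le_le (fun _ => 0) _ w); auto using is_lim_seq_const.
  intros n; split; auto using Rabs_pos.
Qed.

Lemma is_lim_seq_ratio (u A w : nat -> R) (m : R) : (forall n, 0 < A n) ->
  (forall n, Rabs (u n - m * A n) <= w n * A n) -> is_lim_seq w 0 -> is_lim_seq (fun n => u n / A n) m.
Proof.
  intros HA H Hw.
  apply (is_lim_seq_ext (fun n => (u n - m * A n) / A n + m)).
  - intros n. specialize (HA n). field; lra.
  - replace (Finite m) with (Finite (0 + m)) by (now rewrite Rplus_0_l).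
    apply is_lim_seq_plus'; [|apply is_lim_seq_const].
    apply (is_lim_seq_0_dominated _ w); auto. intros n. specialize (HA n). specialize (H n).
    unfold Rdiv. rewrite Rabs_mult, (Rabs_pos_eq (/ A n)) by (apply Rlt_le, Rinv_0_lt_compat; auto).
    apply Rmult_le_reg_r with (A n); auto. rewrite Rmult_assoc, Rinv_l by lra. lra.
Qed.

Lemma filterlim_Re_Im (u : nat -> C) (l : C) :
  is_lim_seq (fun n => Re (u n)) (Re l) -> is_lim_seq (fun n => Im (u n)) (Im l) ->
  filterlim u eventually (locally l).
Proof.
  intros HRe HIm. apply filterlim_locally; intros eps.
  exact (filter_and _ _ (proj1 (filterlim_locally _ _) HRe eps) (proj1 (filterlim_locally _ _) HIm eps)).
Qed.

Section LimitCurrents.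
Variables a1 b1 a2 b2 : C.
Hypothesis nondeg1 : nondeg a1 b1.
Hypothesis nondeg2 : nondeg a2 b2.

Lemma test_coefficient_Re f : smoothC f -> periodic a1 b1 a2 b2 f ->
  Ck 1 (fun p => Re (f p)) /\ lattice_periodic a1 b1 a2 b2 (fun p => Re (f p)).
Proof. intros Hs Hp. split; [apply (Hs 1%nat)|]. intros p x y Hx Hy. now rewrite Hp. Qed.

Lemma test_coefficient_Im f : smoothC f -> periodic a1 b1 a2 b2 f ->
  Ck 1 (fun p => Im (f p)) /\ lattice_periodic a1 b1 a2 b2 (fun p => Im (f p)).
Proof. intros Hs Hp. split; [apply (Hs 1%nat)|]. intros p x y Hx Hy. now rewrite Hp. Qed.

Lemma smoothC_continuous f : smoothC f -> continuous_fun f.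
Proof. intros H p. destruct (H 0%nat) as [[HRe _] [HIm _]]. apply continuous_Re_Im; auto. Qed.

Lemma test_coefficient_bounded f :
  smoothC f -> periodic a1 b1 a2 b2 f -> exists M, forall p, Cmod (f p) <= M.
Proof.
  intros Hs Hp. assert (Cf := smoothC_continuous f Hs).
  destruct (lattice_periodic_bounded a1 b1 a2 b2 nondeg1 nondeg2 (fun p => Cmod (f p))) as [M HM].
  - auto_continuous.
  - intros p x y Hx Hy. now rewrite Hp.
  - exists M. intros p. eapply Rle_trans; [apply Rle_abs|apply HM].
Qed.

Lemma pull_continuous eta g :
  test_form a1 b1 a2 b2 eta -> twice_Cderivable_curve g -> continuous_fun (pull eta g).
Proof.
  intros [S11 [S12 [S21 [S22 _]]]] Hg. destruct (curve_continuous g Hg) as [C1 [C2 [C1' C2']]].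
  apply smoothC_continuous in S11, S12, S21, S22. unfold pull. auto_continuous.
Qed.

Lemma pull_slice_approximation eta : test_form a1 b1 a2 b2 eta ->
  exists M, 0 <= M /\ forall g z,
    Cmod (pull eta g z - c22 eta (g1 g z, g2 g z) * (Cmod (dg2 g z) ^ 2)%R)%C <=
      M * (Cmod (dg1 g z) ^ 2 + 2 * (Cmod (dg1 g z) * Cmod (dg2 g z))).
Proof.
  intros [S11 [S12 [S21 [_ [P11 [P12 [P21 _]]]]]]].
  destruct (test_coefficient_bounded _ S11 P11) as [M1 B1].
  destruct (test_coefficient_bounded _ S12 P12) as [M2 B2].
  destruct (test_coefficient_bounded _ S21 P21) as [M3 B3].
  exists (Rmax M1 (Rmax M2 M3)). split.
  - eapply Rle_trans; [|apply Rmax_l]. eapply Rle_trans; [apply Cmod_ge_0|apply (B1 (RtoC 0, RtoC 0))].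
  - intros g z. apply pull_main_term; intros p; eauto using Rle_trans, Rmax_l, Rmax_r.
Qed.

Section ConcentratedSequence.
Variables (g : curve) (r eps : nat -> R) (e : nat -> C) (e0 : C) (k : averaging).
Hypothesis Hg : twice_Cderivable_curve g.
Hypothesis r_gt0 : forall n, 0 < r n.
Hypothesis eps_bounds : forall n, 0 < eps n <= 1.
Hypothesis eps_to_0 : is_lim_seq eps 0.
Hypothesis e_to_e0 : is_lim_seq (fun n => Cmod (e n - e0)%C) 0.
Hypothesis Hconc : forall n, concentrated k (r n) g (e n) (eps n).

Lemma area_ratio_limit (u : C * C -> R) (v : C -> R) M : Ck 1 u -> lattice_periodic a1 b1 a2 b2 u ->
  0 <= M -> continuous_fun v ->
  (forall z, Rabs (v z - u (g1 g z, g2 g z) * Cmod (dg2 g z) ^ 2)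
    <= M * (Cmod (dg1 g z) ^ 2 + 2 * (Cmod (dg1 g z) * Cmod (dg2 g z)))) ->
  is_lim_seq (fun n => area k (r n) v / area k (r n) (density g)) (slice_mean a2 b2 u e0).
Proof.
  intros Hu Hp HM Cv Hv.
  destruct (Lipschitz_fst a1 b1 a2 b2 u nondeg1 nondeg2 Hu Hp) as [K1 [K1_ge0 HK1]].
  destruct (slice_length_area a1 b1 a2 b2 u nondeg1 nondeg2 Hu Hp e0) as [K2 [K2_ge0 HK2]].
  set (K := 3 * M + Rabs (slice_mean a2 b2 u e0) + K1 + K2).
  apply (is_lim_seq_ratio _ _ (fun n => K * (sqrt (eps n) + Cmod (e n - e0)%C))).
  - intros n. apply (Hconc n).
  - intros n. apply (area_main_term u); auto using Rlt_le. exact (proj1 Hu).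
  - replace (Finite 0) with (Rbar_mult K (0 + 0)) by (simpl; f_equal; ring).
    apply is_lim_seq_scal_l, is_lim_seq_plus'; [|exact e_to_e0].
    rewrite <- sqrt_0. apply (is_lim_seq_continuous sqrt eps 0); auto.
    apply continuity_pt_filterlim, continuous_sqrt.
Qed.

Lemma normalized_current_limit eta : test_form a1 b1 a2 b2 eta ->
  filterlim (fun n => normalized_current k g (r n) eta) eventually
    (locally (CInt (fun s => CInt (fun t => c22 eta (e0, (s * a2 + t * b2)%C)) 0 1) 0 1)).
Proof.
  intros Heta. destruct (pull_slice_approximation eta Heta) as [M [HM approx]].
  assert (Cpull := pull_continuous eta g Heta Hg).
  destruct Heta as [_ [_ [_ [S22 [_ [_ [_ P22]]]]]]].
  destruct (test_coefficient_Re _ S22 P22) as [SRe PRe].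
  destruct (test_coefficient_Im _ S22 P22) as [SIm PIm].
  assert (A_neq0 : forall n, area k (r n) (density g) <> 0) by (intros n; apply Rgt_not_eq, (Hconc n)).
  apply filterlim_Re_Im.
  - apply (is_lim_seq_ext (fun n => area k (r n) (fun z => Re (pull eta g z)) / area k (r n) (density g))).
    { intros n. unfold normalized_current, Cdiv. rewrite <- RtoC_inv by apply A_neq0.
      now rewrite re_scal_r. }
    apply (area_ratio_limit (fun p => Re (c22 eta p)) _ M); auto; [auto_continuous|].
    intros z. eapply Rle_trans; [|apply (approx g z)].
    rewrite <- re_scal_r. apply (re_le_Cmod (_ - _)%C).
  - apply (is_lim_seq_ext (fun n => area k (r n) (fun z => Im (pull eta g z)) / area k (r n) (density g))).
    { intros n. unfold normalized_current, Cdiv. rewrite <- RtoC_inv by apply A_neq0.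
      now rewrite im_scal_r. }
    apply (area_ratio_limit (fun p => Im (c22 eta p)) _ M); auto; [auto_continuous|].
    intros z. eapply Rle_trans; [|apply (approx g z)].
    rewrite <- im_scal_r. apply (Rabs_Im_le_Cmod (_ - _)%C).
Qed.

Lemma boundary_ratio_limit :
  is_lim_seq (fun n => boundary k (r n) (fun z => sqrt (density g z)) / area k (r n) (density g)) 0.
Proof.
  assert (Cd := density_continuous g Hg).
  apply (is_lim_seq_ratio _ _ eps); auto.
  - intros n. apply (Hconc n).
  - intros n. destruct (Hconc n) as [_ [Hlength _]]. rewrite Rmult_0_l, Rminus_0_r, Rabs_pos_eq; auto.
    apply (functional_nonneg _ _ (boundary_positive k (r n) (Rlt_le _ _ (r_gt0 n)))); [auto_continuous|].
    intros z _. apply sqrt_pos.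
Qed.

Lemma limit_current_fiber T : limit_current k a1 b1 a2 b2 g r T ->
  positive_multiple a1 b1 a2 b2 T (fiber1_current a2 b2 e0).
Proof.
  intros [phi [Hphi HT]].
  assert (D : 0 < Rabs (Im (Cconj a2 * b2))) by (now apply Rabs_pos_lt).
  exists (/ Rabs (Im (Cconj a2 * b2))). split; [now apply Rinv_0_lt_compat|].
  intros eta Heta. unfold fiber1_current.
  rewrite Cmult_assoc, <- RtoC_mult, Rinv_l, Cmult_1_l by lra.
  apply (filterlim_locally_unique (V := C_NormedModule) (F := eventually)
    (fun n => normalized_current k g (r (phi n)) eta)); [now apply HT|].
  apply (filterlim_comp _ _ _ phi (fun n => normalized_current k g (r n) eta) _ eventually).
  - now apply eventually_subseq.
  - now apply normalized_current_limit.
Qed.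
End ConcentratedSequence.

Lemma concentrated_produces_fiber (g : curve) (r eps : nat -> R) (e : nat -> C) (e0 : C) :
  twice_Cderivable_curve g -> (forall n, 0 < r n) -> (forall n, 0 < eps n <= 1) ->
  is_lim_seq eps 0 -> is_lim_seq (fun n => Cmod (e n - e0)%C) 0 ->
  (forall k n, concentrated k (r n) g (e n) (eps n)) ->
  produces_multiples_of a1 b1 a2 b2 g r (fiber1_current a2 b2 e0).
Proof.
  intros Hg Hr Heps Leps Le Hconc k. split.
  - split.
    + intros n. apply nonconst_on_of_area; auto. apply (Hconc Ahlfors n).
    + now apply (boundary_ratio_limit g r eps e).
  - intros T. now apply (limit_current_fiber g r eps e).
Qed.
End LimitCurrents.

(** * Exchange of the two factors *)

Definition swap_pair (p : C * C) : C * C := (snd p, fst p).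
Definition swap_curve (g : curve) : curve := Curve (g2 g) (g1 g) (dg2 g) (dg1 g).
Definition swap_form (eta : form11) : form11 :=
  Form11 (fun p => c22 eta (swap_pair p)) (fun p => c21 eta (swap_pair p))
         (fun p => c12 eta (swap_pair p)) (fun p => c11 eta (swap_pair p)).

Lemma swap_form_involutive eta : swap_form (swap_form eta) = eta.
Proof.
  destruct eta. unfold swap_form; simpl. f_equal; apply functional_extensionality; now intros [].
Qed.

Lemma twice_Cderivable_swap g : twice_Cderivable_curve g -> twice_Cderivable_curve (swap_curve g).
Proof. intros [Hfst Hsnd]. now split. Qed.

Lemma Ck_swap k : forall f, Ck k f -> Ck k (fun p => f (swap_pair p)).
Proof.
  induction k as [|k IH]; intros f [Hc H].
  - split; auto. intros p. unfold swap_pair. auto_continuous.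
  - split; [intros p; unfold swap_pair; auto_continuous|].
    intros v Hv. destruct (H (swap_pair v)) as [Hderive HCk].
    { destruct Hv as [->|[->|[->| ->]]]; unfold coord_dir, swap_pair; simpl; tauto. }
    split.
    + intros p. exact (Hderive (swap_pair p)).
    + exact (IH _ HCk).
Qed.

Lemma smoothC_swap f : smoothC f -> smoothC (fun p => f (swap_pair p)).
Proof.
  intros H k. destruct (H k) as [HRe HIm]. split; [exact (Ck_swap k _ HRe)|exact (Ck_swap k _ HIm)].
Qed.

Lemma periodic_swap a1 b1 a2 b2 f :
  periodic a1 b1 a2 b2 f -> periodic a2 b2 a1 b1 (fun p => f (swap_pair p)).
Proof. intros H p x y Hx Hy. exact (H (swap_pair p) y x Hy Hx). Qed.

Lemma test_form_swap a1 b1 a2 b2 eta : test_form a1 b1 a2 b2 eta -> test_form a2 b2 a1 b1 (swap_form eta).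
Proof.
  intros [S11 [S12 [S21 [S22 [P11 [P12 [P21 P22]]]]]]].
  repeat split; simpl; (now apply smoothC_swap) || now apply periodic_swap.
Qed.

Lemma pull_swap eta g : pull eta (swap_curve g) = pull (swap_form eta) g.
Proof. apply functional_extensionality; intros z. unfold pull; simpl. unfold swap_pair; simpl. ring. Qed.

Lemma density_swap g : density (swap_curve g) = density g.
Proof. apply functional_extensionality; intros z. unfold density; simpl. ring. Qed.

Lemma normalized_current_swap k g r eta :
  normalized_current k (swap_curve g) r eta = normalized_current k g r (swap_form eta).
Proof. unfold normalized_current. now rewrite pull_swap, density_swap. Qed.

Lemma nonconst_on_swap g r : nonconst_on (swap_curve g) r -> nonconst_on g r.
Proof. intros [z [Hz H]]. exists z. split; auto. simpl in H. tauto. Qed.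

Lemma limit_current_swap k a1 b1 a2 b2 g r T : limit_current k a1 b1 a2 b2 g r T ->
  limit_current k a2 b2 a1 b1 (swap_curve g) r (fun eta => T (swap_form eta)).
Proof.
  intros [phi [Hphi H]]. exists phi. split; auto. intros eta Heta.
  eapply filterlim_ext; [|apply (H (swap_form eta) (test_form_swap _ _ _ _ _ Heta))].
  intros l; cbv beta. now rewrite normalized_current_swap.
Qed.

Lemma produces_fiber_swap a1 b1 a2 b2 g r e2 :
  produces_multiples_of a2 b2 a1 b1 (swap_curve g) r (fiber1_current a1 b1 e2) ->
  produces_multiples_of a1 b1 a2 b2 g r (fiber2_current a1 b1 e2).
Proof.
  intros H k. destruct (H k) as [[Hnonconst Hratio] Hlimit]. split.
  - split; [intros l; now apply nonconst_on_swap|]. now rewrite density_swap in Hratio.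
  - intros T HT. destruct (Hlimit _ (limit_current_swap _ _ _ _ _ _ _ _ HT)) as [c [Hc HTc]].
    exists c. split; auto. intros eta Heta.
    specialize (HTc (swap_form eta) (test_form_swap _ _ _ _ _ Heta)). cbv beta in HTc.
    rewrite swap_form_involutive in HTc. exact HTc.
Qed.

(** * Concentration of exponentials *)

Lemma Cmod_le_Re_le (z : C) r : Cmod z <= r -> Re z <= r.
Proof. generalize (re_le_Cmod z) (Rle_abs (Re z)); lra. Qed.

Definition peak (N r : R) (z : C) : R := N * exp (N * (Re z - (r - 1/2))).

Lemma Cmod_exp_jet_peak N r z : 0 <= N -> Cmod (exp_jet 1 N (r - 1/2) 1 z) = peak N r z.
Proof. intros HN. rewrite Cmod_exp_jet, Cmod_1 by exact HN. unfold peak. ring. Qed.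

Lemma peak_sqr N r z : peak N r z ^ 2 = N * N * exp (N * (1 - 2 * (r - Re z))).
Proof.
  unfold peak.
  replace (N * (1 - 2 * (r - Re z))) with (N * (Re z - (r - 1/2)) + N * (Re z - (r - 1/2))) by field.
  rewrite exp_plus. ring.
Qed.

Definition bump (r delta : R) (z : C) : R :=
  (1 - (r - Re z) * (2 / delta) + Rabs (1 - (r - Re z) * (2 / delta))) / 2.

Lemma bump_continuous r delta : continuous_fun (bump r delta).
Proof. unfold bump, Rdiv. auto_continuous. Qed.

Lemma bump_ge_0 r delta z : 0 <= bump r delta z.
Proof.
  unfold bump. set (x := 1 - (r - Re z) * (2 / delta)).
  generalize (Rle_abs (- x)). rewrite Rabs_Ropp. lra.
Qed.

Lemma bump_center r delta : bump r delta r = 1.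
Proof. unfold bump; simpl. rewrite Rminus_diag, Rmult_0_l, Rminus_0_r, Rabs_R1. field. Qed.

Lemma bump_le_1 r delta z : 0 < delta -> Re z <= r -> bump r delta z <= 1.
Proof.
  intros Hd Hz. unfold bump.
  assert (0 <= (r - Re z) * (2 / delta)) by (apply Rmult_le_pos; [lra|apply Rlt_le, Rdiv_lt_0_compat; lra]).
  unfold Rabs; destruct Rcase_abs; lra.
Qed.

Lemma bump_eq_0 r delta z : 0 < delta -> delta / 2 <= r - Re z -> bump r delta z = 0.
Proof.
  intros Hd Hz. unfold bump.
  assert (1 <= (r - Re z) * (2 / delta)).
  { replace 1 with (delta / 2 * (2 / delta)) by (field; lra).
    apply Rmult_le_compat_r; [apply Rlt_le, Rdiv_lt_0_compat|]; lra. }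
  unfold Rabs; destruct Rcase_abs; lra.
Qed.

(* Between the maximum [N exp (N / 2)] of the peak and its square. *)
Definition peak_height (N delta : R) : R := N * exp (N * (1 - delta)) / delta.

Section Peak.
Variables N r delta : R.
Hypothesis N_ge1 : 1 <= N.
Hypothesis delta_bounds : 0 < delta <= 1/4.

Lemma peak_height_delta : delta * peak_height N delta = N * exp (N * (1 - delta)).
Proof. unfold peak_height. field. lra. Qed.

Lemma peak_height_ge : N * exp (N * (1 - delta)) <= peak_height N delta.
Proof.
  rewrite <- peak_height_delta.
  assert (0 <= peak_height N delta); [|nra].
  unfold peak_height, Rdiv. repeat apply Rmult_le_pos; [lra|apply Rlt_le, exp_pos|].
  apply Rlt_le, Rinv_0_lt_compat; lra.
Qed.

Lemma peak_height_ge_1 : 1 <= peak_height N delta.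
Proof.
  eapply Rle_trans; [|apply peak_height_ge]. generalize (exp_ineq1_le (N * (1 - delta))). nra.
Qed.

Lemma peak_bounds z : Re z <= r -> 0 <= peak N r z <= peak_height N delta.
Proof.
  intros Hz. unfold peak. split.
  - apply Rmult_le_pos; [lra|apply Rlt_le, exp_pos].
  - eapply Rle_trans; [|exact peak_height_ge].
    apply Rmult_le_compat_l; [lra|]. apply exp_le. nra.
Qed.

Lemma peak_sqr_le_off_center z : delta <= r - Re z -> peak N r z ^ 2 <= peak_height N delta.
Proof.
  intros Hz. apply Rmult_le_reg_l with delta; [lra|]. rewrite peak_height_delta, peak_sqr.
  apply Rle_trans with (delta * (N * N * (exp (N * (1 - delta)) * exp (- (N * delta))))).
  - apply Rmult_le_compat_l; [lra|]. apply Rmult_le_compat_l; [nra|].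
    rewrite <- exp_plus. apply exp_le. nra.
  - assert (decay : N * delta * exp (- (N * delta)) <= 1).
    { rewrite exp_Ropp. apply Rmult_le_reg_r with (exp (N * delta)); [apply exp_pos|].
      rewrite Rmult_assoc, Rinv_l by (apply Rgt_not_eq, exp_pos).
      generalize (exp_ineq1_le (N * delta)); lra. }
    replace (delta * (N * N * (exp (N * (1 - delta)) * exp (- (N * delta)))))
      with (N * exp (N * (1 - delta)) * (N * delta * exp (- (N * delta)))) by ring.
    assert (0 <= N * exp (N * (1 - delta))) by (apply Rmult_le_pos; [lra|apply Rlt_le, exp_pos]).
    nra.
Qed.

Lemma bump_le_peak_sqr z : Re z <= r ->
  N * delta * peak_height N delta * bump r delta z <= peak N r z ^ 2.
Proof.
  intros Hz. rewrite (Rmult_assoc N), peak_height_delta.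
  destruct (Rle_lt_dec (delta / 2) (r - Re z)) as [Hfar|Hnear].
  - rewrite bump_eq_0, Rmult_0_r by lra. apply pow2_ge_0.
  - assert (Hb := bump_le_1 r delta z (proj1 delta_bounds) Hz).
    assert (Hexp := exp_pos (N * (1 - delta))).
    apply Rle_trans with (N * (N * exp (N * (1 - delta))) * 1).
    + apply Rmult_le_compat_l; [nra|exact Hb].
    + rewrite peak_sqr, Rmult_1_r, Rmult_assoc.
      repeat (apply Rmult_le_compat_l; [lra|]). apply exp_le. nra.
Qed.
End Peak.

(* Laplace's method: the mass of [peak N r ^ 2] near [z = r] outgrows the height that bounds the peak on the
   circle and its square at distance more than [delta] from [z = r]. *)
Lemma peak_mass_dominates k r delta S : 0 < r -> 0 < delta <= 1/4 ->
  exists N0, 1 <= N0 /\ forall N, N0 <= N ->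
    S * peak_height N delta <= area k r (fun z => peak N r z ^ 2).
Proof.
  intros Hr Hd. assert (PL := area_positive k r (Rlt_le _ _ Hr)).
  assert (Cb := bump_continuous r delta).
  set (c := area k r (bump r delta)).
  assert (Hc : 0 < c) by (apply area_gt_0; auto using bump_ge_0; rewrite bump_center; lra).
  assert (Hdc : 0 < delta * c) by (apply Rmult_lt_0_compat; lra).
  assert (HS : 0 <= Rabs S / (delta * c))
    by (apply Rmult_le_pos; [apply Rabs_pos|now apply Rlt_le, Rinv_0_lt_compat]).
  exists (1 + Rabs S / (delta * c)). split; [lra|]. intros N HN.
  assert (N_ge1 : 1 <= N) by lra.
  apply Rle_trans with (area k r (fun z => N * delta * peak_height N delta * bump r delta z)).
  - rewrite (functional_scal _ _ PL) by exact Cb. fold c.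
    replace (N * delta * peak_height N delta * c) with (N * (delta * c) * peak_height N delta) by ring.
    apply Rmult_le_compat_r; [generalize (peak_height_ge_1 N delta N_ge1 Hd); lra|].
    apply Rle_trans with (Rabs S / (delta * c) * (delta * c)).
    + replace (Rabs S / (delta * c) * (delta * c)) with (Rabs S) by (field; lra). apply Rle_abs.
    + apply Rmult_le_compat_r; lra.
  - apply (functional_le _ _ PL); [auto_continuous|unfold peak; auto_continuous|].
    intros z Hz. apply bump_le_peak_sqr; auto. now apply Cmod_le_Re_le.
Qed.

Definition concentration_error (k : averaging) (r K D : R) : R :=
  (2 * K + 1) * boundary k r (fun _ => 1) + K ^ 2 * area k r (fun _ => 1)
  + D * (2 + 2 * K ^ 2) * area k r (fun _ => 1).

Section PeakedDerivative.
Variables (k : averaging) (r : R) (g : curve) (e : C) (P : C -> R) (y eps K D : R).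
Hypothesis r_gt0 : 0 < r.
Hypothesis Hg : twice_Cderivable_curve g.
Hypothesis P_continuous : continuous_fun P.
Hypothesis y_ge1 : 1 <= y.
Hypothesis eps_gt0 : 0 < eps.
Hypothesis K_ge0 : 0 <= K.
Hypothesis D_ge0 : 0 <= D.
Hypothesis P_bounds : forall z, Cmod z <= r -> 0 <= P z <= y.
Hypothesis dg1_le : forall z, Cmod z <= r -> Cmod (dg1 g z) <= K.
Hypothesis dg2_near_P : forall z, Cmod z <= r -> Cmod (dg2 g z) <= P z + K /\ P z <= Cmod (dg2 g z) + K.
Hypothesis near_or_off_peak : forall z, Cmod z <= r ->
  Cmod (g1 g z - e)%C <= 2 * eps \/ (Cmod (g1 g z - e)%C <= D /\ P z ^ 2 <= y).

Let one_area : R := area k r (fun _ => 1).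
Let one_boundary : R := boundary k r (fun _ => 1).

Lemma area_density_lower S : S * y <= area k r (fun z => P z ^ 2) ->
  (S / 2 - K ^ 2 * one_area) * y <= area k r (density g).
Proof.
  intros Hmass. assert (PL := area_positive k r (Rlt_le _ _ r_gt0)).
  assert (Cd := density_continuous g Hg).
  assert (one_ge0 : 0 <= one_area)
    by (apply (functional_nonneg _ _ PL); [auto_continuous|intros; lra]).
  apply Rle_trans with (area k r (fun z => / 2 * P z ^ 2 + - K ^ 2 * 1)).
  - rewrite (functional_plus _ _ PL), !(functional_scal _ _ PL) by auto_continuous. fold one_area.
    assert (0 <= K ^ 2 * one_area) by (apply Rmult_le_pos; [apply pow2_ge_0|auto]).
    nra.
  - apply (functional_le _ _ PL); [auto_continuous|auto_continuous|].
    intros z Hz. destruct (dg2_near_P z Hz) as [_ HP]. specialize (P_bounds z Hz).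
    assert (P z ^ 2 <= (Cmod (dg2 g z) + K) ^ 2) by (apply pow_incr; lra).
    unfold density. generalize (pow2_ge_0 (Cmod (dg1 g z))) (pow2_ge_0 (Cmod (dg2 g z) - K)). nra.
Qed.

Lemma boundary_length_upper :
  boundary k r (fun z => sqrt (density g z)) <= (2 * K + 1) * one_boundary * y.
Proof.
  assert (PL := boundary_positive k r (Rlt_le _ _ r_gt0)). assert (Cd := density_continuous g Hg).
  apply Rle_trans with (boundary k r (fun z => (2 * K + 1) * y * 1)).
  - apply (functional_le _ _ PL); [auto_continuous|auto_continuous|].
    intros z Hz. destruct (dg2_near_P z Hz) as [dg2_le _]. specialize (dg1_le z Hz). specialize (P_bounds z Hz).
    assert (dg1_ge0 := Cmod_ge_0 (dg1 g z)). assert (dg2_ge0 := Cmod_ge_0 (dg2 g z)).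
    apply Rle_trans with (Cmod (dg1 g z) + Cmod (dg2 g z)); [|nra].
    rewrite <- (sqrt_pow2 (Cmod (dg1 g z) + Cmod (dg2 g z))) by lra.
    apply sqrt_le_1_alt. unfold density. nra.
  - rewrite (functional_scal _ _ PL) by auto_continuous. fold one_boundary. lra.
Qed.

Lemma first_factor_area_upper : area k r (fun z => Cmod (dg1 g z) ^ 2) <= K ^ 2 * one_area * y.
Proof.
  assert (PL := area_positive k r (Rlt_le _ _ r_gt0)).
  destruct (curve_continuous g Hg) as [_ [_ [C1' _]]].
  apply Rle_trans with (area k r (fun z => K ^ 2 * y * 1)).
  - apply (functional_le _ _ PL); [auto_continuous|auto_continuous|].
    intros z Hz. apply Rle_trans with (K ^ 2).
    + apply pow_incr. split; [apply Cmod_ge_0|now apply dg1_le].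
    + generalize (pow2_ge_0 K). nra.
  - rewrite (functional_scal _ _ PL) by auto_continuous. fold one_area. lra.
Qed.

Lemma off_fiber_area_upper : area k r (fun z => Cmod (g1 g z - e)%C * Cmod (dg2 g z) ^ 2)
  <= 2 * eps * area k r (density g) + D * (2 + 2 * K ^ 2) * one_area * y.
Proof.
  assert (PL := area_positive k r (Rlt_le _ _ r_gt0)). assert (Cd := density_continuous g Hg).
  destruct (curve_continuous g Hg) as [C1 [_ [_ C2']]].
  apply Rle_trans with (area k r (fun z => 2 * eps * density g z + D * (2 + 2 * K ^ 2) * y * 1)).
  - apply (functional_le _ _ PL); [auto_continuous|auto_continuous|].
    intros z Hz. destruct (dg2_near_P z Hz) as [dg2_le _].
    assert (Q1 := pow2_ge_0 (Cmod (dg1 g z))). assert (Q2 := pow2_ge_0 (Cmod (dg2 g z))).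
    assert (eps_density : 2 * eps * Cmod (dg2 g z) ^ 2 <= 2 * eps * density g z)
      by (apply Rmult_le_compat_l; unfold density; lra).
    assert (K2 := pow2_ge_0 K).
    destruct (near_or_off_peak z Hz) as [Hnear|[Hfar HP]].
    + assert (0 <= D * (2 + 2 * K ^ 2) * y) by (repeat apply Rmult_le_pos; lra).
      assert (Cmod (g1 g z - e)%C * Cmod (dg2 g z) ^ 2 <= 2 * eps * Cmod (dg2 g z) ^ 2)
        by now apply Rmult_le_compat_r.
      lra.
    + assert (Cmod (dg2 g z) ^ 2 <= (P z + K) ^ 2) by (apply pow_incr; split; [apply Cmod_ge_0|exact dg2_le]).
      assert (dg2_sqr_le : Cmod (dg2 g z) ^ 2 <= (2 + 2 * K ^ 2) * y)
        by (generalize (pow2_ge_0 (P z - K)); nra).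
      assert (Cmod (g1 g z - e)%C * Cmod (dg2 g z) ^ 2 <= D * ((2 + 2 * K ^ 2) * y))
        by (apply Rmult_le_compat; auto using Cmod_ge_0).
      assert (0 <= 2 * eps * Cmod (dg2 g z) ^ 2) by (apply Rmult_le_pos; lra).
      lra.
  - rewrite (functional_plus _ _ PL), !(functional_scal _ _ PL) by auto_continuous. fold one_area. lra.
Qed.

Lemma concentrated_of_peak :
  2 * (concentration_error k r K D / eps + K ^ 2 * one_area + 1) * y <= area k r (fun z => P z ^ 2) ->
  concentrated k r g e (3 * eps).
Proof.
  intros Hmass. apply area_density_lower in Hmass.
  set (A := area k r (density g)) in *.
  assert (one_area_ge0 : 0 <= one_area).
  { apply (functional_nonneg r (area k r)); [apply area_positive; lra|auto_continuous|intros; lra]. }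
  assert (one_boundary_ge0 : 0 <= one_boundary).
  { apply (functional_nonneg r (boundary k r)); [apply boundary_positive; lra|auto_continuous|intros; lra]. }
  assert (K2 := pow2_ge_0 K).
  set (length_error := (2 * K + 1) * one_boundary). set (first_error := K ^ 2 * one_area) in *.
  set (off_error := D * (2 + 2 * K ^ 2) * one_area).
  assert (length_ge0 : 0 <= length_error) by (apply Rmult_le_pos; lra).
  assert (first_ge0 : 0 <= first_error) by (apply Rmult_le_pos; lra).
  assert (off_ge0 : 0 <= off_error) by (repeat apply Rmult_le_pos; lra).
  change (concentration_error k r K D) with (length_error + first_error + off_error) in Hmass.
  set (error := length_error + first_error + off_error) in *.
  assert (HA : (error / eps + 1) * y <= A) by (eapply Rle_trans; [|exact Hmass]; right; field; lra).
  assert (quotient_ge0 : 0 <= error / eps)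
    by (apply Rmult_le_pos; [unfold error; lra|now apply Rlt_le, Rinv_0_lt_compat]).
  assert (error_small : error * y <= eps * A).
  { apply Rle_trans with (eps * (error / eps * y)); [right; field; lra|].
    apply Rmult_le_compat_l; lra. }
  assert (A_gt0 : 0 < A) by nra.
  assert (eps_A : 0 < eps * A) by now apply Rmult_lt_0_compat.
  assert (first := first_factor_area_upper). assert (boundary := boundary_length_upper).
  assert (off := off_fiber_area_upper).
  fold A length_error first_error off_error in first, boundary, off |- *. unfold error in error_small.
  repeat split; fold A; nra.
Qed.
End PeakedDerivative.

Lemma Cmod_sub_radius_sqr (z : C) r : Cmod z <= r -> Cmod (z - r)%C ^ 2 <= 2 * r * (r - Re z).
Proof.
  intros Hz. assert (H : Cmod z ^ 2 <= r ^ 2) by (apply pow_incr; split; [apply Cmod_ge_0|auto]).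
  rewrite Cmod2_alt in *. destruct z as [x y]. unfold Re, Im in *; simpl in *. nra.
Qed.

Lemma Cmod_sub_radius_le (z : C) r : 0 <= r -> Cmod z <= r -> Cmod (z - r)%C <= 2 * r.
Proof.
  intros Hr Hz. unfold Cminus. eapply Rle_trans; [apply Cmod_triangle|].
  rewrite Cmod_opp, Cmod_R, Rabs_pos_eq; lra.
Qed.

Lemma near_rightmost_point r w : 0 < r -> 0 < w ->
  exists delta, 0 < delta <= 1/4 /\
    forall z : C, Cmod z <= r -> r - Re z < delta -> Cmod (z - r)%C <= w.
Proof.
  intros Hr Hw. assert (Hw2 : 0 < w ^ 2 / (2 * r)) by (apply Rdiv_lt_0_compat; [now apply pow_lt|lra]).
  exists (Rmin (1/4) (w ^ 2 / (2 * r))). split; [split; [apply Rmin_pos; lra|apply Rmin_l]|].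
  intros z Hz Hnear. assert (Hmin := Rmin_r (1/4) (w ^ 2 / (2 * r))).
  assert (Hsqr := Cmod_sub_radius_sqr z r Hz).
  apply Rsqr_incr_0_var; [|lra]. rewrite !Rsqr_pow2. eapply Rle_trans; [exact Hsqr|].
  apply Rle_trans with (2 * r * (w ^ 2 / (2 * r))); [apply Rmult_le_compat_l; lra|right; field; lra].
Qed.

Lemma exp_concentrated k r (F : C -> C) (e : C) eps K :
  0 < r -> 0 < eps -> 0 <= K -> (forall z, Cmod z <= r -> Cmod (F z - e)%C <= K * Cmod (z - r)%C) ->
  exists N0, forall N, N0 <= N -> forall g : curve, twice_Cderivable_curve g ->
    (forall z, Cmod z <= r -> Cmod (g1 g z - F z)%C <= eps /\ Cmod (dg1 g z) <= K /\
       Cmod (dg2 g z - exp_jet 1 N (r - 1/2) 1 z)%C <= K) ->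
    concentrated k r g e (3 * eps).
Proof.
  intros Hr Heps HK HF.
  assert (Hw : 0 < eps / (K + 1)) by (apply Rdiv_lt_0_compat; lra).
  destruct (near_rightmost_point r (eps / (K + 1)) Hr Hw) as [delta [Hdelta near]].
  set (D := eps + K * (2 * r)).
  assert (D_ge0 : 0 <= D) by (assert (0 <= K * (2 * r)) by (apply Rmult_le_pos; lra); unfold D; lra).
  destruct (peak_mass_dominates k r delta
    (2 * (concentration_error k r K D / eps + K ^ 2 * area k r (fun _ => 1) + 1)) Hr Hdelta)
    as [N0 [N0_ge1 mass]].
  exists N0. intros N HN g Hg Happrox. assert (N_ge1 : 1 <= N) by lra.
  apply (concentrated_of_peak k r g e (peak N r) (peak_height N delta) eps K D); auto.
  - unfold peak. auto_continuous.
  - now apply peak_height_ge_1.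
  - intros z Hz. apply peak_bounds; auto. now apply Cmod_le_Re_le.
  - intros z Hz. apply (Happrox z Hz).
  - intros z Hz. destruct (Happrox z Hz) as [_ [_ near_exp]]. rewrite <- Cmod_exp_jet_peak by lra.
    set (E := exp_jet 1 N (r - 1/2) 1 z) in *. split.
    + replace (dg2 g z) with (E + (dg2 g z - E))%C by ring. eapply Rle_trans; [apply Cmod_triangle|lra].
    + replace E with (dg2 g z + - (dg2 g z - E))%C at 1 by ring.
      eapply Rle_trans; [apply Cmod_triangle|]. rewrite Cmod_opp; lra.
  - intros z Hz. destruct (Happrox z Hz) as [near_F _]. specialize (HF z Hz).
    assert (to_e : Cmod (g1 g z - e)%C <= eps + K * Cmod (z - r)%C).
    { replace (g1 g z - e)%C with ((g1 g z - F z) + (F z - e))%C by ring.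
      eapply Rle_trans; [apply Cmod_triangle|lra]. }
    destruct (Rle_lt_dec delta (r - Re z)) as [Hfar|Hnear].
    + right. split; [|now apply peak_sqr_le_off_center]. eapply Rle_trans; [exact to_e|].
      apply Rplus_le_compat_l, Rmult_le_compat_l; [exact HK|]. apply Cmod_sub_radius_le; lra.
    + left. specialize (near z Hz Hnear).
      assert (small : K * Cmod (z - r)%C <= (K + 1) * (eps / (K + 1)))
        by (apply Rmult_le_compat; try lra; apply Cmod_ge_0).
      replace ((K + 1) * (eps / (K + 1))) with eps in small by (field; lra). lra.
Qed.

Lemma continuous_bounded_disc (f : C -> C) r : continuous_fun f -> 0 <= r ->
  exists M, 0 <= M /\ forall z, Cmod z <= r -> Cmod (f z) <= M.
Proof.
  intros Hf Hr.
  destruct (continuous_bounded_polydisc (fun p => Cmod (f (fst p))) r) as [M HM]; [auto_continuous|].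
  assert (HM' : forall z, Cmod z <= r -> Cmod (f z) <= M).
  { intros z Hz. apply (HM z z Hz Hz). }
  exists M. split; [|exact HM'].
  eapply Rle_trans; [apply Cmod_ge_0|apply (HM' 0%C)]. now rewrite Cmod_0.
Qed.

Lemma eventually_forall_averaging (P : averaging -> R -> Prop) :
  (forall k, exists N0, forall N, N0 <= N -> P k N) -> exists N0, forall N, N0 <= N -> forall k, P k N.
Proof.
  intros H. destruct (H Ahlfors) as [Na Ha], (H Nevanlinna) as [Nn Hn].
  exists (Rmax Na Nn). intros N HN [|].
  - apply Ha. eapply Rle_trans; [apply Rmax_l|exact HN].
  - apply Hn. eapply Rle_trans; [apply Rmax_r|exact HN].
Qed.

Section ConcentrationStep.
Variables (n : nat) (r eta : R).
Hypothesis r_gt0 : 0 < r.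
Hypothesis eta_gt0 : 0 < eta.

Definition jet_close (F G : nat -> C -> C) : Prop :=
  forall m z, (m <= n)%nat -> Cmod z <= r - 1 -> Cmod (F m z - G m z)%C <= eta.

Lemma jet_plus_exp_close v k : 0 < k -> exists N0, forall N, N0 <= N ->
  forall G, jet_close (jet_plus G (exp_jet v N (r - 1 + k))) G.
Proof.
  intros Hk. destruct (exp_jet_small v k eta (r - 1) n Hk eta_gt0) as [N0 HN0].
  exists N0. intros N HN G m z Hm Hz. unfold jet_plus.
  replace (G m z + exp_jet v N (r - 1 + k) m z - G m z)%C with (exp_jet v N (r - 1 + k) m z) by ring.
  now apply HN0.
Qed.

Lemma jet_hitting_target G e : is_jet G ->
  exists F, is_jet F /\ jet_close F G /\ F 0%nat r = e.
Proof.
  intros HG. destruct (jet_plus_exp_close (e - G 0%nat r)%C 1 Rlt_0_1) as [N HN].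
  replace (r - 1 + 1) with r in HN by ring.
  exists (jet_plus G (exp_jet (e - G 0%nat r)%C N r)). split; [|split].
  - apply is_jet_plus; [exact HG|apply is_jet_exp].
  - apply (HN N (Rle_refl N)).
  - unfold jet_plus, exp_jet. replace (N * (r - r))%C with (RtoC 0) by ring. rewrite cexp_0. simpl. ring.
Qed.

Lemma concentration_step (G1 G2 : nat -> C -> C) e eps : is_jet G1 -> is_jet G2 -> 0 < eps ->
  exists F1 F2, is_jet F1 /\ is_jet F2 /\ jet_close F1 G1 /\ jet_close F2 G2 /\
    forall g, twice_Cderivable_curve g ->
      (forall z, Cmod z <= r -> Cmod (g1 g z - F1 0%nat z)%C <= eps /\
         Cmod (dg1 g z - F1 1%nat z)%C <= 2 /\ Cmod (dg2 g z - F2 1%nat z)%C <= 2) ->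
      forall k, concentrated k r g e (3 * eps).
Proof.
  intros HG1 HG2 Heps.
  destruct (jet_hitting_target G1 e HG1) as [F1 [HF1 [close1 hit]]].
  destruct (continuous_bounded_disc (F1 1%nat) r) as [K1 [K1_ge0 B1]];
    [apply (is_Cderive_continuous _ _ (HF1 1%nat))|lra|].
  destruct (continuous_bounded_disc (G2 1%nat) r) as [K2 [K2_ge0 B2]];
    [apply (is_Cderive_continuous _ _ (HG2 1%nat))|lra|].
  set (K := K1 + K2 + 2).
  assert (F1_near_e : forall z, Cmod z <= r -> Cmod (F1 0%nat z - e)%C <= K * Cmod (z - r)%C).
  { intros z Hz. rewrite <- hit. apply (Cmod_mean_value (F1 0%nat) (F1 1%nat)); [apply HF1|].
    intros t Ht. apply Rle_trans with K1; [|unfold K; lra]. apply B1, Cmod_segment_le; auto.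
    rewrite Cmod_R, Rabs_pos_eq; lra. }
  destruct (eventually_forall_averaging
    (fun k N => forall g : curve, twice_Cderivable_curve g -> _ -> concentrated k r g e (3 * eps))
    (fun k => exp_concentrated k r (F1 0%nat) e eps K r_gt0 Heps ltac:(unfold K; lra) F1_near_e)) as [N1 HN1].
  destruct (jet_plus_exp_close 1%C (1/2)) as [N2 HN2]; [lra|].
  replace (r - 1 + 1/2) with (r - 1/2) in HN2 by field.
  set (N := Rmax N1 N2).
  exists F1, (jet_plus G2 (exp_jet 1 N (r - 1/2))).
  split; [exact HF1|]. split; [apply is_jet_plus; [exact HG2|apply is_jet_exp]|].
  split; [exact close1|]. split; [apply HN2, Rmax_r|].
  intros g Hg Happrox k. apply (HN1 N); [apply Rmax_l|exact Hg|].
  intros z Hz. destruct (Happrox z Hz) as [near_F1 [near_F1' near_F2']].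
  specialize (B1 z Hz). specialize (B2 z Hz). split; [exact near_F1|]. split.
  - replace (dg1 g z) with ((dg1 g z - F1 1%nat z) + F1 1%nat z)%C by ring.
    eapply Rle_trans; [apply Cmod_triangle|]. unfold K; lra.
  - unfold jet_plus in near_F2'.
    replace (dg2 g z - exp_jet 1 N (r - 1/2) 1 z)%C with
      ((dg2 g z - (G2 1%nat z + exp_jet 1 N (r - 1/2) 1 z)) + G2 1%nat z)%C by ring.
    eapply Rle_trans; [apply Cmod_triangle|]. unfold K; lra.
Qed.
End ConcentrationStep.

(** * Construction of the curve *)

Definition dyadic (i : nat) : R :=
  let (p, t) := Cantor.of_nat i in let (u, v) := Cantor.of_nat t in (INR u - INR v) * (1/2) ^ p.

Lemma dyadic_dense x eps : 0 < eps -> exists i, Rabs (dyadic i - x) <= eps.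
Proof.
  intros He. destruct (half_pow_small eps He) as [p Hp].
  set (k := Int_part (x * 2 ^ p)).
  exists (Cantor.to_nat (p, Cantor.to_nat (Z.to_nat k, Z.to_nat (- k)))).
  unfold dyadic. rewrite !Cantor.cancel_of_to.
  replace (INR (Z.to_nat k) - INR (Z.to_nat (- k))) with (IZR k)
    by (rewrite !INR_IZR_INZ, <- minus_IZR; f_equal; lia).
  assert (B := base_Int_part (x * 2 ^ p)). fold k in B.
  replace (IZR k * (1/2)^p - x) with ((IZR k - x * 2 ^ p) * (1/2)^p).
  - assert (Hpos := half_pow_pos p). rewrite Rabs_mult, (Rabs_pos_eq ((1/2)^p)) by lra.
    assert (Rabs (IZR k - x * 2 ^ p) <= 1) by (apply Rabs_le; lra). nra.
  - replace x with (x * (2 * (1/2)) ^ p) at 2 by (replace (2 * (1/2)) with 1 by field; rewrite pow1; ring).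
    rewrite Rpow_mult_distr. ring.
Qed.

(* Every pair of a factor and a dyadic point is visited infinitely often. *)
Definition target (n : nat) : bool * C :=
  let (i, _) := Cantor.of_nat n in let (b, t) := Cantor.of_nat i in let (x, y) := Cantor.of_nat t in
  (Nat.eqb b 0, (dyadic x, dyadic y)).

Definition near_target (b : bool) (e : C) (eps : R) (n : nat) : Prop :=
  fst (target n) = b /\ Cmod (snd (target n) - e)%C <= eps.

Lemma target_dense b e eps k : 0 < eps -> exists n, (k <= n)%nat /\ near_target b e eps n.
Proof.
  intros He. destruct (dyadic_dense (Re e) (eps/2)) as [x Hx]; [lra|].
  destruct (dyadic_dense (Im e) (eps/2)) as [y Hy]; [lra|].
  exists (Cantor.to_nat (Cantor.to_nat ((if b then 0 else 1)%nat, Cantor.to_nat (x, y)), k)).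
  split; [|split].
  - eapply Nat.le_trans; [|apply Cantor.to_nat_non_decreasing]. lia.
  - unfold target. rewrite !Cantor.cancel_of_to. now destruct b.
  - unfold target. rewrite !Cantor.cancel_of_to. simpl snd.
    eapply Rle_trans; [apply Cmod_le_Rabs_Re_Im|].
    change (Rabs (dyadic x - Re e) + Rabs (dyadic y - Im e) <= eps). lra.
Qed.

Lemma dependent_choice {A : Type} (I : A -> Prop) (R : nat -> A -> A -> Prop) (a0 : A) :
  I a0 -> (forall n a, I a -> exists a', I a' /\ R n a a') ->
  exists f : nat -> A, f 0%nat = a0 /\ forall n, I (f n) /\ R n (f n) (f (S n)).
Proof.
  intros Ha0 step.
  pose (next := fun n (s : {a | I a}) =>
    constructive_indefinite_description _ (step n (proj1_sig s) (proj2_sig s))).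
  pose (f := fix f n : {a | I a} := match n with
    | O => exist I a0 Ha0
    | S n => exist I (proj1_sig (next n (f n))) (proj1 (proj2_sig (next n (f n))))
    end).
  exists (fun n => proj1_sig (f n)). split; [reflexivity|]. intros n. split; [exact (proj2_sig (f n))|].
  exact (proj2 (proj2_sig (next n (f n)))).
Qed.

Lemma target_subsequence b e : exists N : nat -> nat,
  (forall l, (l + 3 <= N l)%nat) /\ (forall l, (N l < N (S l))%nat) /\
  forall l, near_target b e ((1/2)^l) (N l).
Proof.
  destruct (dependent_choice (fun _ => True)
    (fun l n n' => (n < n')%nat /\ near_target b e ((1/2)^l) n') 2%nat) as [f [f0 Hf]]; [exact I| |].
  - intros l n _. destruct (target_dense b e ((1/2)^l) (S n) (half_pow_pos l)) as [n' H]. now exists n'.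
  - exists (fun l => f (S l)). split; [|split].
    + induction l as [|l IH]; [destruct (Hf 0%nat) as [_ [H _]]|destruct (Hf (S l)) as [_ [H _]]]; lia.
    + intros l. apply (Hf (S l)).
    + intros l. apply (Hf l).
Qed.

Definition jets : Type := ((nat -> C -> C) * (nat -> C -> C))%type.

Definition are_jets (s : jets) : Prop := is_jet (fst s) /\ is_jet (snd s).

Definition orient (b : bool) (g : curve) : curve := if b then g else swap_curve g.

(* [2 * (1/2)^n] bounds the sum of all corrections after step [n] on the disc of radius [n + 1]. *)
Definition curve_near_jets (n : nat) (s : jets) (g : curve) : Prop :=
  forall z, Cmod z <= INR (S n) ->
    Cmod (g1 g z - fst s 0%nat z)%C <= 2 * (1/2)^n /\ Cmod (g2 g z - snd s 0%nat z)%C <= 2 * (1/2)^n /\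
    Cmod (dg1 g z - fst s 1%nat z)%C <= 2 /\ Cmod (dg2 g z - snd s 1%nat z)%C <= 2.

Definition concentrating_step (n : nat) (s s' : jets) : Prop :=
  jet_close n (INR (S n)) ((1/2)^n) (fst s') (fst s) /\
  jet_close n (INR (S n)) ((1/2)^n) (snd s') (snd s) /\
  forall g, twice_Cderivable_curve g -> curve_near_jets n s' g ->
    forall k, concentrated k (INR (S n)) (orient (fst (target n)) g) (snd (target n)) (6 * (1/2)^n).

Lemma concentrating_step_exists n s : are_jets s -> exists s', are_jets s' /\ concentrating_step n s s'.
Proof.
  intros [J1 J2]. assert (Hr : 0 < INR (S n)) by (apply lt_0_INR; lia).
  assert (Hp := half_pow_pos n). assert (Hp2 : 0 < 2 * (1/2)^n) by lra.
  unfold concentrating_step. replace (6 * (1/2)^n) with (3 * (2 * (1/2)^n)) by ring.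
  destruct (fst (target n)); unfold orient.
  - destruct (concentration_step n _ _ Hr Hp (fst s) (snd s) (snd (target n)) _ J1 J2 Hp2)
      as [F1 [F2 [K1 [K2 [C1 [C2 Hconc]]]]]].
    exists (F1, F2). split; [now split|]. split; [exact C1|]. split; [exact C2|].
    intros g Hg Hnear. apply Hconc; [exact Hg|].
    intros z Hz. specialize (Hnear z Hz). simpl in Hnear. tauto.
  - destruct (concentration_step n _ _ Hr Hp (snd s) (fst s) (snd (target n)) _ J2 J1 Hp2)
      as [F2 [F1 [K2 [K1 [C2 [C1 Hconc]]]]]].
    exists (F1, F2). split; [now split|]. split; [exact C1|]. split; [exact C2|].
    intros g Hg Hnear. apply Hconc; [now apply twice_Cderivable_swap|].
    intros z Hz. specialize (Hnear z Hz). simpl in Hnear |- *. tauto.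
Qed.

Lemma is_jet_twice_Cderivable F : is_jet F -> twice_Cderivable (F 0%nat) (F 1%nat).
Proof.
  intros J. split; [apply J|]. exists (F 2%nat).
  split; [apply J|exact (is_Cderive_continuous _ _ (J 2%nat))].
Qed.

Lemma universal_curve : exists g, twice_Cderivable_curve g /\ forall n k,
  concentrated k (INR (S n)) (orient (fst (target n)) g) (snd (target n)) (6 * (1/2)^n).
Proof.
  destruct (dependent_choice are_jets concentrating_step (fun _ _ => RtoC 0, fun _ _ => RtoC 0)) as [s [_ Hs]].
  - split; apply is_jet_zero.
  - apply concentrating_step_exists.
  - assert (close_INR : forall n F G, jet_close n (INR (S n)) ((1/2)^n) F G -> forall m z,
      (m <= n)%nat -> Cmod z <= INR n -> Cmod (F m z - G m z)%C <= (1/2)^n).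
    { intros n F G H m z Hm Hz. apply H; [exact Hm|]. rewrite S_INR. lra. }
    destruct (is_jet_limit (fun n => fst (s n))) as [F [JF LF]].
    { intros n; apply (Hs n). }
    { intros n. apply close_INR, (Hs n). }
    destruct (is_jet_limit (fun n => snd (s n))) as [G [JG LG]].
    { intros n; apply (Hs n). }
    { intros n. apply close_INR, (Hs n). }
    exists (Curve (F 0%nat) (G 0%nat) (F 1%nat) (G 1%nat)).
    assert (Hg : twice_Cderivable_curve (Curve (F 0%nat) (G 0%nat) (F 1%nat) (G 1%nat)))
      by (split; now apply is_jet_twice_Cderivable).
    split; [exact Hg|]. intros n. apply (Hs n); [exact Hg|]. intros z Hz.
    assert (tail : 4 * (1/2)^(S n) = 2 * (1/2)^n) by (simpl; field).
    assert (tail_le : 2 * (1/2)^n <= 2)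
      by (generalize (half_pow_decreasing 0 n (Nat.le_0_l n)); simpl; lra).
    assert (HF := fun m Hm => LF (S n) m z Hm Hz). assert (HG := fun m Hm => LG (S n) m z Hm Hz).
    rewrite tail in HF, HG. simpl g1; simpl g2; simpl dg1; simpl dg2.
    assert (sym : forall a b : C, Cmod (a - b)%C = Cmod (b - a)%C)
      by (intros a b; rewrite <- Cmod_opp; f_equal; ring).
    rewrite !(sym (F _ z)), !(sym (G _ z)).
    repeat split; (apply HF || apply HG || (eapply Rle_trans; [apply HF || apply HG|exact tail_le])); lia.
Qed.

Lemma concentrated_fiber_radii a1 b1 a2 b2 g b e :
  nondeg a1 b1 -> nondeg a2 b2 -> twice_Cderivable_curve g ->
  (forall n k, fst (target n) = b -> concentrated k (INR (S n)) g (snd (target n)) (6 * (1/2)^n)) ->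
  exists r, radii r /\ produces_multiples_of a1 b1 a2 b2 g r (fiber1_current a2 b2 e).
Proof.
  intros nondeg1 nondeg2 Hg Hconc. destruct (target_subsequence b e) as [N [N_ge [N_incr Hnear]]].
  exists (fun l => INR (S (N l))). split; [split|].
  - intros l. split; [apply lt_0_INR; lia|]. apply lt_INR. specialize (N_incr l). lia.
  - apply (is_lim_seq_le_p_loc INR); [|apply is_lim_seq_INR].
    exists 0%nat. intros l _. apply le_INR. specialize (N_ge l). lia.
  - apply (concentrated_produces_fiber a1 b1 a2 b2 nondeg1 nondeg2 g _
      (fun l => 6 * (1/2)^(N l)) (fun l => snd (target (N l)))).
    + exact Hg.
    + intros l; apply lt_0_INR; lia.
    + intros l. assert (N_ge3 : (3 <= N l)%nat) by (specialize (N_ge l); lia).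
      generalize (half_pow_pos (N l)) (half_pow_decreasing 3 (N l) N_ge3). simpl. lra.
    + apply (is_lim_seq_0_dominated _ (fun l => 6 * (1/2)^l)).
      * intros l. assert (Hl : (l <= N l)%nat) by (specialize (N_ge l); lia).
        generalize (half_pow_pos (N l)) (half_pow_decreasing l (N l) Hl). intros.
        rewrite Rabs_pos_eq; lra.
      * replace (Finite 0) with (Rbar_mult 6 0) by (simpl; now rewrite Rmult_0_r).
        apply is_lim_seq_scal_l, is_lim_seq_half_pow.
    + apply (is_lim_seq_0_dominated _ (fun l => (1/2)^l)); [|apply is_lim_seq_half_pow].
      intros l. rewrite Rabs_pos_eq by apply Cmod_ge_0. apply Hnear.
    + intros k l. apply Hconc, Hnear.
Qed.

Theorem theoremB (a1 b1 a2 b2 : C) (h1 : nondeg a1 b1) (h2 : nondeg a2 b2) :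
  exists g : curve, entire g /\
  (forall e1 : C, exists r : nat -> R, radii r /\
     produces_nevanlinna g r /\ produces_ahlfors g r /\
     (forall T, nevanlinna_current a1 b1 a2 b2 g r T ->
        positive_multiple a1 b1 a2 b2 T (fiber1_current a2 b2 e1)) /\
     (forall T, ahlfors_current a1 b1 a2 b2 g r T ->
        positive_multiple a1 b1 a2 b2 T (fiber1_current a2 b2 e1))) /\
  (forall e2 : C, exists r : nat -> R, radii r /\
     produces_nevanlinna g r /\ produces_ahlfors g r /\
     (forall T, nevanlinna_current a1 b1 a2 b2 g r T ->
        positive_multiple a1 b1 a2 b2 T (fiber2_current a1 b1 e2)) /\
     (forall T, ahlfors_current a1 b1 a2 b2 g r T ->
        positive_multiple a1 b1 a2 b2 T (fiber2_current a1 b1 e2))).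
Proof.
  destruct universal_curve as [g [Hg Hconc]]. exists g. split; [split; apply Hg|split].
  - intros e1. destruct (concentrated_fiber_radii a1 b1 a2 b2 g true e1 h1 h2 Hg) as [r [Hr H]].
    { intros n k Hn. generalize (Hconc n k). now rewrite Hn. }
    exists r. split; [exact Hr|]. now apply nevanlinna_ahlfors_multiples.
  - intros e2.
    destruct (concentrated_fiber_radii a2 b2 a1 b1 (swap_curve g) false e2 h2 h1) as [r [Hr H]].
    { now apply twice_Cderivable_swap. }
    { intros n k Hn. generalize (Hconc n k). now rewrite Hn. }
    exists r. split; [exact Hr|]. now apply nevanlinna_ahlfors_multiples, produces_fiber_swap.
Qed.
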